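(* Let $a>0$ and let $q\in L^2(0,a)$ be real-valued and even ($q(x)=q(a-x)$), and place the same potential $q$ on every edge. For the periodic Schrödinger operators $H=-\frac{d^2}{dx^2}+q$ with continuity–Kirchhoff vertex conditions on Archimedean tilings: (a) for the truncated hexagonal tiling $(3,12^2)$, $\sigma_p(H_{trH})=\{\rho^2: S(a,\rho)=0\text{ or }S'(a,\rho)=0\text{ or }S'(a,\rho)=-\frac23\}$; (b) the point spectra of the operators on the snub square tiling $(3^2,4,3,4)$, the rhombi-trihexagonal tiling $(3,4,6,4)$, the snub trihexagonal tiling $(3^4,6)$ and the truncated trihexagonal tiling $(4,6,12)$ coincide and equal $\{\rho^2: S(a,\rho)=0\}$.
   Context: Each tiling is viewed as an infinite metric graph $G$ in the plane whose edges are the sides of its regular polygons, all of length $a$, each edge identified with $[0,a]$. Vertex configurations: truncated hexagonal $(3,12,12)$; snub square $(3,3,4,3,4)$; rhombi-trihexagonal $(3,4,6,4)$; snub trihexagonal $(3,3,3,3,6)$; truncated trihexagonal $(4,6,12)$. The operator $H$ acts by $y_e\mapsto -y_e''+qy_e$ on each edge, with domain the functions $\mathbf y=(y_e)$ with $y_e\in H^2(e)$, $\sum_e\|y_e\|^2_{H^2(e)}<\infty$, continuous at each vertex and with the sum of outgoing derivatives at each vertex equal to zero; it is self-adjoint and periodic with respect to the translation lattice of the tiling. $\sigma_p$ denotes the point spectrum (the set of eigenvalues). $S(x,\rho)$ denotes the solution of $-y''+qy=\rho^2y$ on $[0,a]$ with $S(0,\rho)=0$, $S'(0,\rho)=1$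 (prime is $d/dx$). *)

(* Defs.v *)
From HB Require Import structures.
From mathcomp Require Import all_boot all_order all_algebra.
From mathcomp Require Import all_classical all_reals all_analysis.
Set Implicit Arguments. Unset Strict Implicit. Unset Printing Implicit Defensive.
Import Order.TTheory GRing.Theory Num.Theory.
Import numFieldNormedType.Exports.
Local Open Scope classical_set_scope.
Local Open Scope ring_scope.

(* A periodic graph is given by the number [k] of vertex orbits under the    *)
(* translation lattice Z^2 and a list of edge orbits (i, j, n1, n2): the     *)
(* edge orbit contains, for every n in Z^2, the edge from vertex (n, i) to   *)
(* vertex (n + (n1,n2), j).  Vertices are (n, i) with n : int * int, i < k.   *)
(* Every edge e is identified with [0,a], x = 0 at its origin, x = a at its  *)
(* terminus.                                                                 *)
Record pgraph := PGraph { pg_k : nat; pg_edges : seq (nat * nat * int * int) }.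

Definition ed (i j : nat) (n1 n2 : int) : nat * nat * int * int := (i, j, n1, n2).
Arguments ed i%_N j%_N n1%_R n2%_R.

Definition pg_m (G : pgraph) : nat := size (pg_edges G).

Definition pg_E (G : pgraph) : Type := ((int * int) * 'I_(pg_m G))%type.
(* the type of vertices (only indices i < pg_k G are actual vertices; the
   others are isolated of degree 0 and carry no edge) *)
Definition pg_V : Type := ((int * int) * nat)%type.

Definition pg_src (G : pgraph) (j : nat) : nat := (nth (0, 0, 0, 0) (pg_edges G) j).1.1.1.
Definition pg_dst (G : pgraph) (j : nat) : nat := (nth (0, 0, 0, 0) (pg_edges G) j).1.1.2.
Definition pg_shift (G : pgraph) (j : nat) : int * int :=
  ((nth (0, 0, 0, 0) (pg_edges G) j).1.2, (nth (0, 0, 0, 0) (pg_edges G) j).2).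

Definition origin (G : pgraph) (e : pg_E G) : pg_V := (e.1, pg_src G e.2).
Definition terminus (G : pgraph) (e : pg_E G) : pg_V :=
  ((e.1.1 + (pg_shift G e.2).1, e.1.2 + (pg_shift G e.2).2), pg_dst G e.2).

(* The five Archimedean tilings, edge length normalised.  The lists were     *)
(* produced from explicit planar coordinates; the comments give the motif.   *)
(* Lattice basis b1, b2; each vertex of the tiling is b_i-translate of a     *)
(* motif vertex.  For every vertex, the cyclic order of faces was checked to *)
(* be the stated vertex configuration.                                       *)

(* truncated hexagonal (3,12,12): honeycomb with edge L = 1 + 2/sqrt3,
   b1 = (3L/2, sqrt3 L/2), b2 = (3L/2, -sqrt3 L/2), vertices at distance
   1/sqrt3 from the honeycomb vertices (0,0), (L,0) along its three edges. *)
Definition trH_tiling : pgraph := PGraph 6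
  [:: ed 0 2 (-1) 0; ed 0 1 0 (-1); ed 0 3 0 0; ed 1 2 (-1) 1; ed 1 5 0 0;
      ed 2 4 0 0; ed 3 4 0 0; ed 3 5 0 0; ed 4 5 0 0].

(* snub square (3,3,4,3,4): b1 = (s,0), b2 = (0,s), s = sqrt(2+sqrt3); unit
   squares centred at 0 and (s/2,s/2), rotated relative to each other by 30 deg. *)
Definition snS_tiling : pgraph := PGraph 4
  [:: ed 0 1 (-1) 0; ed 0 2 0 (-1); ed 0 3 0 (-1); ed 0 1 0 0; ed 0 3 0 0;
      ed 1 2 0 (-1); ed 1 2 0 0; ed 1 3 1 0; ed 2 3 0 0; ed 2 3 1 0].

(* rhombi-trihexagonal (3,4,6,4): unit hexagons centred on the triangular
   lattice of spacing 1 + sqrt3 (b1 = (d,0), b2 = (d/2, d sqrt3/2)). *)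
Definition rTH_tiling : pgraph := PGraph 6
  [:: ed 0 1 (-1) 0; ed 0 5 0 (-1); ed 0 2 0 0; ed 0 4 0 0; ed 1 2 0 0;
      ed 1 3 0 0; ed 1 5 0 0; ed 2 3 0 (-1); ed 2 4 0 0; ed 3 5 0 0;
      ed 3 4 1 0; ed 4 5 0 0].

(* snub trihexagonal (3,3,3,3,6): unit hexagons centred on the triangular
   lattice of spacing sqrt7, rotated by atan(sqrt3/5). *)
Definition snTH_tiling : pgraph := PGraph 6
  [:: ed 0 1 (-1) 0; ed 0 3 0 (-1); ed 0 5 0 (-1); ed 0 2 0 0; ed 0 4 0 0;
      ed 1 2 0 0; ed 1 3 0 0; ed 1 5 0 0; ed 1 4 1 0; ed 2 3 0 (-1);
      ed 2 4 0 0; ed 2 5 0 0; ed 3 5 0 0; ed 3 4 1 0; ed 4 5 0 0].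

(* truncated trihexagonal (4,6,12): unit dodecagons centred on the triangular
   lattice of spacing 3 + sqrt3. *)
Definition trTH_tiling : pgraph := PGraph 12
  [:: ed 0 11 0 (-1); ed 0 1 0 0; ed 0 5 0 0; ed 1 2 (-1) 0; ed 1 8 0 0;
      ed 2 3 0 0; ed 2 7 0 0; ed 3 4 0 0; ed 3 10 0 0; ed 4 5 0 0;
      ed 4 9 0 0; ed 5 6 0 (-1); ed 6 7 0 0; ed 6 11 0 0; ed 7 8 1 0;
      ed 8 9 0 0; ed 9 10 0 0; ed 10 11 0 0].

Definition L2 (R : realType) (a : R) (q : R -> R) : Prop :=
  measurable_fun `[0, a] q /\
  (@lebesgue_measure R).-integrable `[0, a] (fun x => ((q x) ^+ 2)%:E).

(* y in H^2(0,a), with y1 = y' and y2 = y'' : y and y' are absolutely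
   continuous on [0,a] (indefinite integrals) and y'' in L^2(0,a). *)
Definition H2 (R : realType) (a : R) (y y1 y2 : R -> R) : Prop :=
  L2 a y2 /\
  (forall x, 0 <= x <= a -> y x = y 0 + Rintegral (@lebesgue_measure R) `[0, x] y1) /\
  (forall x, 0 <= x <= a -> y1 x = y1 0 + Rintegral (@lebesgue_measure R) `[0, x] y2).

Definition H2norm2 (R : realType) (a : R) (y y1 y2 : R -> R) : \bar R :=
  (\int[@lebesgue_measure R]_(x in (`[0%R, a]%classic : set R)) ((y x) ^+ 2 + (y1 x) ^+ 2 + (y2 x) ^+ 2)%:E)%E.

(* A complex-valued function u + i v (u, v real) on [0,a] satisfies
   -y'' + q y = lam y a.e., with lam = al + i be. *)
Definition ode (R : realType) (a : R) (q : R -> R) (al be : R)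
    (u u2 v v2 : R -> R) : Prop :=
  {ae @lebesgue_measure R, forall x, x \in `[0, a] ->
     - u2 x + q x * u x = al * u x - be * v x /\
     - v2 x + q x * v x = be * u x + al * v x}.

(* Eigenvalues of H on the periodic metric graph G (complex Hilbert space;   *)
(* a complex function is a pair (real part, imaginary part)).                *)
(* U e, U1 e, U2 e : real part of y_e and its first/second derivatives;      *)
(* V e, V1 e, V2 e : imaginary part.                                         *)
Definition is_eigenfunction (R : realType) (G : pgraph) (a : R) (q : R -> R)
    (al be : R) (U U1 U2 V V1 V2 : pg_E G -> R -> R) : Prop :=
  (forall e, H2 a (U e) (U1 e) (U2 e) /\ H2 a (V e) (V1 e) (V2 e)) /\
  (\esum_(e in [set: pg_E G]) (H2norm2 a (U e) (U1 e) (U2 e) + H2norm2 a (V e) (V1 e) (V2 e)) < +oo)%E /\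
  (exists fU fV : pg_V -> R, forall e : pg_E G,
      U e 0 = fU (origin e) /\ U e a = fU (terminus e) /\
      V e 0 = fV (origin e) /\ V e a = fV (terminus e)) /\
  (* Kirchhoff: the sum of outgoing derivatives at each vertex vanishes;
     the outgoing derivative is y_e'(0) at the origin, -y_e'(a) at the terminus *)
  (forall (n : int * int) (i : nat),
      \sum_(j < pg_m G | pg_src G j == i) U1 (n, j) 0
      - \sum_(j < pg_m G | pg_dst G j == i)
            U1 ((n.1 - (pg_shift G j).1, n.2 - (pg_shift G j).2), j) a = 0 /\
      \sum_(j < pg_m G | pg_src G j == i) V1 (n, j) 0
      - \sum_(j < pg_m G | pg_dst G j == i)
            V1 ((n.1 - (pg_shift G j).1, n.2 - (pg_shift G j).2), j) a = 0) /\
  (forall e, ode a q al be (U e) (U2 e) (V e) (V2 e)) /\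
  (exists e x, 0 <= x <= a /\ (U e x != 0 \/ V e x != 0)).

(* the point spectrum, as a set of complex numbers al + i be ~ (al, be) *)
Definition point_spectrum (R : realType) (G : pgraph) (a : R) (q : R -> R)
    : set (R * R) :=
  [set l | exists U U1 U2 V V1 V2 : pg_E G -> R -> R,
             is_eigenfunction a q l.1 l.2 U U1 U2 V V1 V2].

(* S(., rho) with rho^2 = lam = al + i be: the solution of -y'' + q y = lam y,
   S(0) = 0, S'(0) = 1; (u, u1, u2) real part of S, S', S''; (v, v1, v2)
   imaginary part. *)
Definition is_S (R : realType) (a : R) (q : R -> R) (al be : R)
    (u u1 u2 v v1 v2 : R -> R) : Prop :=
  H2 a u u1 u2 /\ H2 a v v1 v2 /\ ode a q al be u u2 v v2 /\
  u 0 = 0 /\ v 0 = 0 /\ u1 0 = 1 /\ v1 0 = 0.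

(* {rho^2 : P(S(a,rho), S'(a,rho))}, where P is given on real and imaginary
   parts: P (Re S(a)) (Im S(a)) (Re S'(a)) (Im S'(a)). *)
Definition S_set (R : realType) (a : R) (q : R -> R) (P : R -> R -> R -> R -> Prop)
    : set (R * R) :=
  [set l | exists u u1 u2 v v1 v2 : R -> R,
             is_S a q l.1 l.2 u u1 u2 v v1 v2 /\ P (u a) (v a) (u1 a) (v1 a)].

(* Main.v *)
(* Where S(a) <> 0, the Wronskian of an edge component with S, and with its
   reflection x |-> a - x (a solution since q is even), turns an eigenfunction
   into a square-summable vertex function F whose sum over the neighbours of v
   is d S'(a) F(v).  Cayley-Hamilton for the Floquet matrix gives a scalar
   recurrence F(s) = \sum_t w_t F(s + t) with every t lexicographically
   negative, as long as the leading coefficient of the dispersion polynomial is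
   nonzero.  The restrictions of its solutions to an N x N box then form a space
   of dimension O(N); such a space is small at some coordinate of the box, and
   translating F to that coordinate gives |F(s)|^2 = O(1/N).  The leading
   coefficient is 1 except on the truncated hexagonal tiling, where it is
   - mu (mu + 2), and both roots have eigenvectors supported on a dodecagon.
   Where S(a) = 0 one has S'(a) = 1 or S'(a) = -1, and signed copies of S around
   an even cycle form an eigenfunction.  At an eigenvalue S is a
   combination of edge components of an eigenfunction and their reflections: if
   all of these were proportional to one function not vanishing at 0, then F
   would be multiplied by the same sign r along every edge, which the vanishing
   result at mu = d r excludes. *)
Require Import Defs.
From HB Require Import structures.
From mathcomp Require Import all_boot all_order all_algebra.
From mathcomp Require Import all_classical all_reals all_analysis.
From mathcomp Require Import measurable_realfun.
From mathcomp Require Import complex zify ring lra.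
Set Implicit Arguments. Unset Strict Implicit. Unset Printing Implicit Defensive.
Import Order.TTheory GRing.Theory Num.Theory.
Import numFieldNormedType.Exports.
Local Open Scope ring_scope.
Local Open Scope complex_scope.

Local Notation Re := complex.Re.
Local Notation Im := complex.Im.

(** * Recurrences with square-summable solutions *)

Section SmallCoordinate.
Local Open Scope sesquilinear_scope.

(* The diagonal of the orthogonal projection onto V has sum \rank V, and its
   k-th entry bounds |v_k|^2 / |v|^2 on V by the Cauchy-Schwarz inequality. *)
Lemma exists_small_coordinate (C : numClosedFieldType) (m n : nat) (V : 'M[C]_(m, n)) :
  (0 < n)%N ->
  exists k : 'I_n, forall v : 'rV[C]_n, (v <= V)%MS ->
    n%:R * `|v 0 k| ^+ 2 <= (\rank V)%:R * \sum_j `|v 0 j| ^+ 2.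
Proof.
move=> n_gt0; set r := \rank V.
pose U := schmidt (row_base V).
have Uun : U *m U^t* = 1%:M.
  by apply/unitarymxP/schmidt_unitarymx; rewrite rank_leq_col.
have UV : (U :=: V)%MS.
  by apply: eqmx_trans (eq_row_base V); apply: eqmx_schmidt_free; rewrite row_base_free.
pose P := U^t* *m U.
have PP : P *m P = P by rewrite /P mulmxA -[U^t* *m _ *m _]mulmxA Uun mulmx1.
have Pt : P^t* = P by rewrite /P trmx_mul map_mxM /= trmxCK.
have vP v : (v <= V)%MS -> v = v *m P.
  rewrite -UV => /submxP[w ->].
  by rewrite /P mulmxA -[w *m U *m _]mulmxA Uun mulmx1.
have trP : \sum_k P k k = r%:R by rewrite -/(\tr P) mxtrace_mulC Uun mxtrace1.
clearbody P.
have Pkk k : \sum_j `|P k j| ^+ 2 = P k k.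
  rewrite -[in RHS]PP mxE; apply: eq_bigr => j _.
  by rewrite normCK -[in X in _ = _ * X]Pt !mxE.
have Pge0 k : 0 <= P k k by rewrite -Pkk sumr_ge0 // => j _; rewrite exprn_ge0.
(* The n diagonal entries sum to r, so they cannot all exceed r / n. *)
have [k kP] : exists k, n%:R * P k k <= r%:R.
  apply/existsP; apply: contraT; rewrite negb_exists => /forallP Hn.
  have Hk k : r%:R < n%:R * P k k.
    by rewrite real_ltNge ?Hn // ger0_real // ?mulr_ge0 ?ler0n.
  have : \sum_(k < n) (r%:R : C) < \sum_(k < n) n%:R * P k k.
    by apply: ltr_sum => //; apply/hasP; exists (Ordinal n_gt0);
      rewrite // mem_index_enum.
  by rewrite -mulr_sumr trP sumr_const card_ord mulr_natl ltxx.
exists k => v vV.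
have vk : v 0 k = dotmx v (row k P).
  rewrite {1}(vP _ _ vV) dotmxE !mxE; apply: eq_bigr => j _.
  by rewrite -[in LHS]Pt !mxE.
have CS : `|v 0 k| ^+ 2 <= dotmx v v * dotmx (row k P) (row k P).
  by rewrite vk; have [] := CauchySchwarz (@dotmx C n) v (row k P).
have E w : dotmx w w = \sum_j `|(w : 'rV[C]_n) 0 j| ^+ 2.
  by rewrite dotmxE mxE; apply: eq_bigr => j _; rewrite normCK !mxE.
apply: le_trans (_ : n%:R * (dotmx v v * dotmx (row k P) (row k P)) <= _).
  by rewrite ler_wpM2l ?ler0n.
rewrite !E.
have -> : \sum_j `|(row k P) 0 j| ^+ 2 = P k k.
  by rewrite -Pkk; apply: eq_bigr => j _; rewrite mxE.
rewrite mulrCA mulrC; apply: ler_wpM2r => //.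
by rewrite sumr_ge0 // => j _; rewrite exprn_ge0.
Qed.

End SmallCoordinate.

Definition lex_neg (s : int * int) : bool := (s.1 < 0) || (s.1 == 0) && (s.2 < 0).

Definition in_square (d : nat) (s : int * int) : bool :=
  (`|s.1|%N <= d)%N && (`|s.2|%N <= d)%N.

Lemma card_ord_lt (N d : nat) : (#|[set x : 'I_N | (x < d)%N]| <= d)%N.
Proof.
rewrite cardE -(size_map val) -[leqRHS](size_iota 0).
apply: uniq_leq_size; first by rewrite map_inj_uniq ?enum_uniq //; apply: val_inj.
by move=> _ /mapP[x + ->]; rewrite mem_enum inE mem_iota.
Qed.

Lemma card_ord_ge (N d : nat) : (#|[set x : 'I_N | (N <= x + d)%N]| <= d)%N.
Proof.
apply: leq_trans (card_ord_lt N d); rewrite -(card_imset _ rev_ord_inj).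
apply: subset_leq_card; apply/fintype.subsetP => _ /imsetP[x + ->]; rewrite !inE /=.
by have := ltn_ord x; lia.
Qed.

(** * Solutions of a lexicographic recurrence on a finite box *)

Section Box.
Variables (C : numClosedFieldType) (d N : nat) (w : seq (C * (int * int))).
Hypothesis w_lex : all (fun t => lex_neg t.2 && in_square d t.2) w.

Let n := #|{: 'I_N * 'I_N}|.
Let pos (k : 'I_n) : int * int := ((enum_val k).1%:Z, (enum_val k).2%:Z).
(** Positions from which a shift in [w] may leave the box. A lexicographically negative shift never
    increases the first coordinate, so only three sides of the box count. *)
Let bdry (p : 'I_N * 'I_N) := [|| (p.1 < d)%N, (p.2 < d)%N | (N <= p.2 + d)%N].
Let T := [set k : 'I_n | bdry (enum_val k)].

Lemma pos_inj : injective pos.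
Proof.
move=> k l [E1 E2]; apply: enum_val_inj.
rewrite [LHS]surjective_pairing [RHS]surjective_pairing.
by congr (_, _); apply: val_inj.
Qed.

Lemma card_bdry : (#|T| <= 3 * d * N)%N.
Proof.
rewrite -(card_imset _ (@enum_val_inj _ {: 'I_N * 'I_N})).
apply: leq_trans (_ : #|finset.setX [set x : 'I_N | (x < d)%N] [set: 'I_N]
   :|: finset.setX [set: 'I_N] [set x : 'I_N | (x < d)%N]
   :|: finset.setX [set: 'I_N] [set x : 'I_N | (N <= x + d)%N]| <= _)%N.
  apply: subset_leq_card; apply/fintype.subsetP => _ /imsetP[k + ->].
  by rewrite !inE /bdry; case: (enum_val k) => x y /=; rewrite ?andbT -orbA.
rewrite (leq_trans (leq_card_setU _ _)) //.
apply: (@leq_trans ((d * N + N * d) + N * d)%N); last by lia.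
apply: leq_add; last first.
  by rewrite cardsX cardsT card_ord leq_mul // card_ord_ge.
rewrite (leq_trans (leq_card_setU _ _)) //.
by apply: leq_add; rewrite cardsX cardsT card_ord leq_mul // card_ord_lt.
Qed.

(** The left kernel of [M] consists of the functions on the box that satisfy the recurrence off [T];
    the zero columns impose nothing on [T]. *)
Let M : 'M[C]_n := \matrix_(k, l) if l \in T then 0 else
  (k == l)%:R - \sum_(t <- w) t.1 * (pos k == pos l + t.2)%:R.

Let D : 'M[C]_(n, #|T|) := \matrix_(k, j) (k == enum_val j)%:R.

Lemma mulM (v : 'rV[C]_n) l : l \notin T ->
  (v *m M) 0 l = v 0 l - \sum_(t <- w) t.1 * \sum_(k | pos k == pos l + t.2) v 0 k.
Proof.
move=> lT; rewrite mxE.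
under eq_bigr => k _ do rewrite !mxE (negbTE lT) mulrBr.
rewrite sumrB; congr (_ - _).
  rewrite (bigD1 l) //= eqxx mulr1 big1 ?addr0 // => k /negbTE ->.
  by rewrite mulr0.
under eq_bigr => k _ do rewrite mulr_sumr.
rewrite exchange_big; apply: eq_bigr => t _; rewrite mulr_sumr [RHS]big_mkcond.
by apply: eq_bigr => k _; case: eqP => _; rewrite ?mulr0 // mulr1 mulrC.
Qed.

(* Off [T], the vanishing of column l of [v *m M] expresses v_l through entries at
   lexicographically smaller positions, so v is determined by its entries on [T]. *)
Lemma rank_box : (\rank (kermx M) <= 3 * d * N)%N.
Proof.
(* Rank-nullity for multiplication by [D], which keeps the entries on [T]: the image has rank at
   most [#|T|], and the kernel is shown to be trivial. *)
apply: leq_trans card_bdry; rewrite -(mxrank_mul_ker _ D).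
suff -> : (kermx M :&: kermx D)%MS = 0 by rewrite mxrank0 addn0 rank_leq_col.
apply/eqP/rowV0P => v; rewrite sub_capmx => /andP[/sub_kermxP vM /sub_kermxP vD].
(* Induction on the row-major index x N + y, which is increasing for the lexicographic order on the
   box. *)
suff v0 (m : nat) (l : 'I_n) : ((enum_val l).1 * N + (enum_val l).2 < m)%N -> v 0 l = 0.
  by apply/rowP => l; rewrite mxE (v0 _ l (leqnn _)).
elim: m l => // m IH l lm; have [lT|lT] := boolP (l \in T).
  have := congr1 (fun A : 'rV_ _ => A 0 (enum_rank_in lT l)) vD.
  rewrite !mxE (bigD1 l) //= big1 ?addr0 => [|k kl]; rewrite !mxE enum_rankK_in //.
    by rewrite eqxx mulr1.
  by rewrite (negbTE kl) mulr0.
have := congr1 (fun A : 'rV_ _ => A 0 l) vM; rewrite mulM // mxE => /eqP.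
rewrite subr_eq0 => /eqP ->; rewrite big_seq big1 // => t /(allP w_lex) /andP[tl _].
rewrite big1 ?mulr0 // => k /eqP; rewrite /pos => -[E1 E2]; apply: IH.
move: (ltn_ord (enum_val k).2) (ltn_ord (enum_val l).2) tl lm; rewrite /lex_neg.
move: E1 E2; set x := (_ (enum_val k).1); set y := (_ (enum_val k).2).
set x' := (_ (enum_val l).1); set y' := (_ (enum_val l).2).
move: x y x' y' => x y x' y' E1 E2 yN y'N /orP[t1|/andP[/eqP t1 t2]] lm.
  have : (x < x')%N by lia.
  by nia.
have -> : x = x' by lia.
by lia.
Qed.

(** The small coordinate k depends only on [M]. Since the recurrence is translation invariant, the
    box can then be placed so that s sits at position k. *)
Lemma box_bound (F : int * int -> C) (B : C) : (0 < N)%N ->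
  (forall s, F s = \sum_(t <- w) t.1 * F (s + t.2)) ->
  (forall s, \sum_(p : 'I_N * 'I_N) `|F (s + (p.1%:Z, p.2%:Z))| ^+ 2 <= B) ->
  forall s, (N * N)%:R * `|F s| ^+ 2 <= (3 * d * N)%:R * B.
Proof.
move=> N0 FE FB s.
have nN : n = (N * N)%N by rewrite /n card_prod !card_ord.
have [|k kP] := exists_small_coordinate (kermx M); first by rewrite nN muln_gt0 N0.
pose s0 := s - pos k; pose v : 'rV[C]_n := \row_k F (s0 + pos k).
have vM : (v <= kermx M)%MS.
  apply/sub_kermxP/rowP => l; have [lT|lT] := boolP (l \in T).
    by rewrite !mxE big1 // => j _; rewrite [M _ _]mxE lT mulr0.
  rewrite mulM // !mxE FE; apply/eqP; rewrite subr_eq0; apply/eqP.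
  apply: eq_big_seq => t /(allP w_lex) /andP[tl td]; congr (_ * _).
  (* Off [T] every shifted position stays in the box, so the sum over matching positions is a single
     value of F. *)
  have [j jE] : exists j, pos j = pos l + t.2.
    move: lT td tl; rewrite inE /bdry !negb_or -!leqNgt -ltnNge => /and3P[].
    rewrite /in_square /lex_neg /pos; case: (enum_val l) => x y /= xd yd yN.
    case: t.2 => t1 t2 /= /andP[t1d t2d] tl.
    have xN := ltn_ord x.
    have x'N : (`|(x%:Z + t1)%R| < N)%N by lia.
    have y'N : (`|(y%:Z + t2)%R| < N)%N by lia.
    exists (enum_rank (Ordinal x'N, Ordinal y'N)); rewrite enum_rankK /=.
    by congr (_, _); rewrite /=; lia.
  rewrite (big_pred1 j) => [|i]; last by rewrite -jE (inj_eq pos_inj).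
  by rewrite mxE jE addrA.
rewrite -nN; have := kP v vM; rewrite mxE /s0 subrK => /le_trans; apply.
have B0 : 0 <= B by apply: le_trans (FB 0); apply: sumr_ge0 => *; rewrite exprn_ge0.
apply: le_trans (_ : (\rank (kermx M))%:R * B <= _); last first.
  by apply: ler_wpM2r => //; rewrite ler_nat rank_box.
apply: ler_wpM2l; rewrite ?ler0n //; apply: le_trans (FB s0).
rewrite (reindex (@enum_val _ {: 'I_N * 'I_N})) /=; last first.
  by apply: onW_bij; apply: enum_val_bij.
by apply: ler_sum => l _; rewrite mxE.
Qed.

End Box.

Lemma bounded_multiples_eq0 (R : realType) (x c : R) :
  0 <= x -> (forall n, n.+1%:R * x <= c) -> x = 0.
Proof.
move=> x0 xc; apply/eqP; rewrite eq_le x0 andbT leNgt; apply/negP => xp.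
by have := xc (Num.truncn (c / x)); rewrite -ler_pdivlMr // leNgt truncnS_gt.
Qed.

(** Square-summability as one bound for the sums over all finite boxes. *)
Definition box_l2 (R : realType) (F : int * int -> R[i]) :=
  exists B : R, forall (N : nat) s,
    \sum_(p : 'I_N * 'I_N) `|F (s + (p.1%:Z, p.2%:Z))| ^+ 2 <= B%:C.

(** [box_bound] reads N^2 |F(s)|^2 <= 3 d N B; after division by N, the multiples of |F(s)|^2 are
    bounded. *)
Lemma l2_recurrence_eq0 (R : realType) (d : nat) (w : seq (R[i] * (int * int)))
    (F : int * int -> R[i]) :
  all (fun t => lex_neg t.2 && in_square d t.2) w ->
  (forall s, F s = \sum_(t <- w) t.1 * F (s + t.2)) ->
  box_l2 F -> forall s, F s = 0.
Proof.
move=> w_lex FE [B FB] s.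
pose x : R := Re (F s) ^+ 2 + Im (F s) ^+ 2.
have bnd N : (0 < N)%N -> N%:R * x <= (3 * d)%:R * B.
  move=> N0; have := box_bound w_lex N0 FE (FB N) s.
  rewrite -add_Re2_Im2 -/x -[(N * N)%:R](rmorph_nat (real_complex R)).
  rewrite -[(3 * d * N)%:R](rmorph_nat (real_complex R)) -!rmorphM lecR => H.
  have N0' : 0 < N%:R :> R by rewrite ltr0n.
  by rewrite -(ler_pM2l N0') !mulrA -natrM (mulrC N%:R) -natrM.
have x0 : x = 0.
  apply: (@bounded_multiples_eq0 _ _ ((3 * d)%:R * B)) => [|n]; last exact: bnd.
  by rewrite /x addr_ge0 ?sqr_ge0.
move/eqP: x0; rewrite /x; case: (F s) => u v /=.
by rewrite paddr_eq0 ?sqr_ge0 // !sqrf_eq0 => /andP[/eqP -> /eqP ->].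
Qed.

(** * Adjacency eigenfunctions of a periodic graph *)

(** Neighbours of the vertex (0, i), with multiplicity: each edge orbit is followed forwards from
    its origin and backwards from its terminus. *)
Definition neighbours (G : pgraph) (i : nat) : seq ((int * int) * nat) :=
  flatten [seq (if e.1.1.1 == i then [:: ((e.1.2, e.2), e.1.1.2)] else [::]) ++
               (if e.1.1.2 == i then [:: ((- e.1.2, - e.2), e.1.1.1)] else [::])
          | e <- pg_edges G].

Definition adjacency_eq (C : pzRingType) (G : pgraph) (mu : C) (F : pg_V -> C) :=
  forall s i, \sum_(b <- neighbours G i) F (s + b.1, b.2) = mu * F (s, i).

(** Formal integer combinations of vertices. They are lists, so that [vm_compute] can normalise them
    and compare the result with the empty list. *)
Definition fsum := seq (int * pg_V).

Fixpoint fsum_add (c : int) (v : pg_V) (l : fsum) : fsum :=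
  if l is t :: l' then
    if t.2 == v then (if t.1 + c == 0 then l' else (t.1 + c, v) :: l')
    else t :: fsum_add c v l'
  else if c == 0 then [::] else [:: (c, v)].

Definition fsum_normal (l : fsum) : fsum := foldr (fun t => fsum_add t.1 t.2) [::] l.

Definition fsum_step (G : pgraph) (l : fsum) : fsum :=
  flatten [seq [seq (t.1, (t.2.1 + b.1, b.2)) | b <- neighbours G t.2.2] | t <- l].

(* The i-th entry (c, r) of an [lpoly] is the coefficient of mu^i of a polynomial in
   mu over Laurent polynomials in two shifts: c is its coefficient at the shift
   (0, 0), and r lists the other ones with their shifts. *)
Definition lpoly := seq (int * seq (int * (int * int))).

(* Horner evaluation of p at the adjacency operator, applied to the vertex (0, i). *)
Fixpoint horner_orbit (G : pgraph) (p : lpoly) (i : nat) : fsum :=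
  if p is (c, r) :: p' then
    fsum_normal (fsum_step G (horner_orbit G p' i) ++
      (c, ((0 : int, 0 : int), i)) :: [seq (t.1, (t.2, i)) | t <- r])
  else [::].

(** The identity p(adjacency) = 0 is tested at one vertex of each orbit; periodicity carries it to
    all translates. The second clause makes every shift other than (0, 0) admissible in a
    recurrence. *)
Definition annihilates (G : pgraph) (p : lpoly) : bool :=
  all (fun i => horner_orbit G p i == [::]) (iota 0 (pg_k G)) &&
  all (fun c => all (fun t => lex_neg t.2 && in_square 4 t.2) c.2) p.

Section Walks.
Variables (C : fieldType) (G : pgraph) (mu : C) (F : pg_V -> C).
Hypothesis FG : adjacency_eq G mu F.

Definition fsum_eval (s : int * int) (l : fsum) : C :=
  \sum_(t <- l) t.1%:~R * F (s + t.2.1, t.2.2).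

Lemma fsum_eval_add s c v l :
  fsum_eval s (fsum_add c v l) = c%:~R * F (s + v.1, v.2) + fsum_eval s l.
Proof.
rewrite /fsum_eval; elim: l => [|[c' v'] l IH] /=.
  by case: eqP => [->|_]; rewrite ?big_cons !big_nil ?mulr0z ?mul0r !addr0.
case: eqP => [->|_]; last by rewrite !big_cons IH addrCA.
case: eqP => [cc|_]; rewrite !big_cons /= addrA -mulrDl -rmorphD /= addrC.
  by rewrite [c + _]addrC cc mulr0z mul0r addr0.
by rewrite [c + _]addrC addrC.
Qed.

Lemma fsum_eval_normal s l : fsum_eval s (fsum_normal l) = fsum_eval s l.
Proof.
elim: l => //= -[c v] l IH.
by rewrite fsum_eval_add IH [RHS]/fsum_eval big_cons.
Qed.

Lemma fsum_eval_step s l : fsum_eval s (fsum_step G l) = mu * fsum_eval s l.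
Proof.
rewrite /fsum_eval big_flatten big_map mulr_sumr; apply: eq_bigr => t _.
rewrite big_map /= mulrCA -FG mulr_sumr; apply: eq_bigr => b _.
by rewrite /= addrA.
Qed.

(** With p specialised at mu, [lead] is the coefficient at the shift (0, 0) and [tail_weights] lists
    the terms at the other shifts. *)
Fixpoint lead (p : lpoly) : C := if p is (c, _) :: p' then c%:~R + mu * lead p' else 0.

Fixpoint tail_weights (p : lpoly) : seq (C * (int * int)) :=
  if p is (_, r) :: p' then
    [seq (t.1%:~R, t.2) | t <- r] ++ [seq (mu * t.1, t.2) | t <- tail_weights p']
  else [::].

(* Applied to an adjacency eigenfunction, p(adjacency) acts as p(mu). *)
Lemma fsum_eval_horner s p i :
  fsum_eval s (horner_orbit G p i) =
  lead p * F (s, i) + \sum_(t <- tail_weights p) t.1 * F (s + t.2, i).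
Proof.
elim: p => [|[c r] p IH] /=; first by rewrite /fsum_eval !big_nil mul0r addr0.
rewrite fsum_eval_normal /fsum_eval big_cat -/(fsum_eval _ _) fsum_eval_step IH.
rewrite big_cons big_map /= addr0 big_cat /= !big_map /=.
have -> : \sum_(t <- tail_weights p) mu * t.1 * F (s + t.2, i) =
    mu * \sum_(t <- tail_weights p) t.1 * F (s + t.2, i).
  by rewrite mulr_sumr; apply: eq_bigr => t _; rewrite mulrA.
set x := \sum_(t <- r) _; set y := \sum_(t <- _) _.
ring.
Qed.

End Walks.

Lemma tail_weights_lex (C : fieldType) (mu : C) (p : lpoly) :
  all (fun c => all (fun t => lex_neg t.2 && in_square 4 t.2) c.2) p ->
  all (fun t => lex_neg t.2 && in_square 4 t.2) (tail_weights mu p).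
Proof.
elim: p => //= -[c r] p IH /= /andP[rP pP].
by rewrite all_cat !all_map /= rP; apply: IH.
Qed.

(** The annihilating polynomial relates only values of F within one orbit i; dividing by its nonzero
    leading coefficient gives a scalar recurrence for s |-> F(s, i). *)
Lemma l2_adjacency_eq0 (R : realType) (G : pgraph) (p : lpoly) (mu : R[i])
    (F : pg_V -> R[i]) :
  annihilates G p -> lead mu p != 0 -> adjacency_eq G mu F ->
  (forall i, (i < pg_k G)%N -> box_l2 (fun s => F (s, i))) ->
  forall s i, (i < pg_k G)%N -> F (s, i) = 0.
Proof.
move=> /andP[/allP p0 pl] g0 FG FB s i ik; set g := lead mu p in g0.
pose w := [seq (- (g^-1 * t.1), t.2) | t <- tail_weights mu p].
apply: (@l2_recurrence_eq0 R 4 w (fun s => F (s, i))); last exact: FB.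
  by rewrite all_map; apply: tail_weights_lex.
move=> {}s; have := fsum_eval_horner FG s p i.
rewrite (eqP (p0 i _)) ?mem_iota // [LHS]big_nil -/g => /esym/eqP.
rewrite addr_eq0 => /eqP /(congr1 (fun x => g^-1 * x)); rewrite mulKf // => ->.
rewrite mulrN mulr_sumr -sumrN big_map; apply: eq_bigr => t _ /=.
by rewrite mulrA mulNr.
Qed.

(* The characteristic polynomials det(mu - A(z)) of the Floquet matrices, multiplied by
   the monomial in z that brings the lexicographically greatest term to (0, 0). *)
Definition trH_cert : lpoly := [:: (0, [::]);
  (-2, [:: (-2, (-2, 0)); (-2, (-2, 1)); (-2, (-1, -1)); (12, (-1, 0)); (-2, (-1, 1));
    (-2, (0, -1))]);
  (-1, [:: (-1, (-2, 0)); (-1, (-2, 1)); (-1, (-1, -1)); (18, (-1, 0)); (-1, (-1, 1));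
    (-1, (0, -1))]);
  (0, [:: (-4, (-1, 0))]);
  (0, [:: (-9, (-1, 0))]);
  (0, [::]);
  (0, [:: (1, (-1, 0))])]%Z.

Definition snS_cert : lpoly := [:: (1, [:: (1, (-4, 0)); (-4, (-3, -1)); (-2, (-3, 0));
    (-4, (-3, 1)); (1, (-2, -2)); (-2, (-2, -1)); (5, (-2, 0)); (-2, (-2, 1));
    (1, (-2, 2)); (-4, (-1, -1)); (-2, (-1, 0)); (-4, (-1, 1))]);
  (0, [:: (-2, (-3, -1)); (-4, (-3, 0)); (-2, (-3, 1)); (-4, (-2, -1)); (-8, (-2, 0));
    (-4, (-2, 1)); (-2, (-1, -1)); (-4, (-1, 0)); (-2, (-1, 1))]);
  (0, [:: (-2, (-3, 0)); (-2, (-2, -1)); (-10, (-2, 0)); (-2, (-2, 1)); (-2, (-1, 0))]);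
  (0, [::]);
  (0, [:: (1, (-2, 0))])]%Z.

Definition rTH_cert : lpoly := [:: (1, [:: (1, (-4, 0)); (-2, (-4, 1)); (1, (-4, 2));
    (-2, (-3, -1)); (2, (-3, 0)); (2, (-3, 1)); (-2, (-3, 2)); (1, (-2, -2));
    (2, (-2, -1)); (-6, (-2, 0)); (2, (-2, 1)); (1, (-2, 2)); (-2, (-1, -2));
    (2, (-1, -1)); (2, (-1, 0)); (-2, (-1, 1)); (1, (0, -2)); (-2, (0, -1))]);
  (0, [::]);
  (0, [:: (-4, (-3, 0)); (-4, (-3, 1)); (-4, (-2, -1)); (24, (-2, 0)); (-4, (-2, 1));
    (-4, (-1, -1)); (-4, (-1, 0))]);
  (0, [:: (-2, (-3, 0)); (-2, (-3, 1)); (-2, (-2, -1)); (-4, (-2, 0)); (-2, (-2, 1));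
    (-2, (-1, -1)); (-2, (-1, 0))]);
  (0, [:: (-12, (-2, 0))]);
  (0, [::]);
  (0, [:: (1, (-2, 0))])]%Z.

Definition snTH_cert : lpoly := [:: (1, [:: (1, (-4, 0)); (-4, (-4, 1)); (1, (-4, 2));
    (-4, (-3, -1)); (4, (-3, 0)); (4, (-3, 1)); (-4, (-3, 2)); (1, (-2, -2));
    (4, (-2, -1)); (-11, (-2, 0)); (4, (-2, 1)); (1, (-2, 2)); (-4, (-1, -2));
    (4, (-1, -1)); (4, (-1, 0)); (-4, (-1, 1)); (1, (0, -2)); (-4, (0, -1))]);
  (0, [:: (-2, (-4, 1)); (-2, (-3, -1)); (-6, (-3, 0)); (-6, (-3, 1)); (-2, (-3, 2));
    (-6, (-2, -1)); (24, (-2, 0)); (-6, (-2, 1)); (-2, (-1, -2)); (-6, (-1, -1));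
    (-6, (-1, 0)); (-2, (-1, 1)); (-2, (0, -1))]);
  (0, [:: (-12, (-3, 0)); (-12, (-3, 1)); (-12, (-2, -1)); (27, (-2, 0));
    (-12, (-2, 1)); (-12, (-1, -1)); (-12, (-1, 0))]);
  (0, [:: (-4, (-3, 0)); (-4, (-3, 1)); (-4, (-2, -1)); (-16, (-2, 0)); (-4, (-2, 1));
    (-4, (-1, -1)); (-4, (-1, 0))]);
  (0, [:: (-15, (-2, 0))]);
  (0, [::]);
  (0, [:: (1, (-2, 0))])]%Z.

Definition trTH_cert : lpoly := [:: (1, [:: (1, (-4, 0)); (2, (-4, 1)); (1, (-4, 2));
    (2, (-3, -1)); (8, (-3, 0)); (8, (-3, 1)); (2, (-3, 2)); (1, (-2, -2));
    (8, (-2, -1)); (15, (-2, 0)); (8, (-2, 1)); (1, (-2, 2)); (2, (-1, -2));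
    (8, (-1, -1)); (8, (-1, 0)); (2, (-1, 1)); (1, (0, -2)); (2, (0, -1))]);
  (0, [::]);
  (0, [:: (-4, (-4, 1)); (-4, (-3, -1)); (-30, (-3, 0)); (-30, (-3, 1)); (-4, (-3, 2));
    (-30, (-2, -1)); (-102, (-2, 0)); (-30, (-2, 1)); (-4, (-1, -2)); (-30, (-1, -1));
    (-30, (-1, 0)); (-4, (-1, 1)); (-4, (0, -1))]);
  (0, [::]);
  (0, [:: (30, (-3, 0)); (30, (-3, 1)); (30, (-2, -1)); (267, (-2, 0)); (30, (-2, 1));
    (30, (-1, -1)); (30, (-1, 0))]);
  (0, [::]);
  (0, [:: (-6, (-3, 0)); (-6, (-3, 1)); (-6, (-2, -1)); (-280, (-2, 0)); (-6, (-2, 1));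
    (-6, (-1, -1)); (-6, (-1, 0))]);
  (0, [::]);
  (0, [:: (111, (-2, 0))]);
  (0, [::]);
  (0, [:: (-18, (-2, 0))]);
  (0, [::]);
  (0, [:: (1, (-2, 0))])]%Z.

Lemma trH_annihilates : annihilates trH_tiling trH_cert.
Proof. by vm_compute. Qed.

Lemma snS_annihilates : annihilates snS_tiling snS_cert.
Proof. by vm_compute. Qed.

Lemma rTH_annihilates : annihilates rTH_tiling rTH_cert.
Proof. by vm_compute. Qed.

Lemma snTH_annihilates : annihilates snTH_tiling snTH_cert.
Proof. by vm_compute. Qed.

Lemma trTH_annihilates : annihilates trTH_tiling trTH_cert.
Proof. by vm_compute. Qed.

(** With mu = 3 S'(a), the roots 0 and -2 become S'(a) = 0 and S'(a) = -2/3. *)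
Lemma trH_lead (C : fieldType) (mu : C) : lead mu trH_cert = - (mu * (mu + 2)).
Proof. by rewrite /=; ring. Qed.

Lemma snS_lead (C : fieldType) (mu : C) : lead mu snS_cert = 1.
Proof. by rewrite /= !(mulr0, addr0). Qed.

Lemma rTH_lead (C : fieldType) (mu : C) : lead mu rTH_cert = 1.
Proof. by rewrite /= !(mulr0, addr0). Qed.

Lemma snTH_lead (C : fieldType) (mu : C) : lead mu snTH_cert = 1.
Proof. by rewrite /= !(mulr0, addr0). Qed.

Lemma trTH_lead (C : fieldType) (mu : C) : lead mu trTH_cert = 1.
Proof. by rewrite /= !(mulr0, addr0). Qed.

Local Open Scope classical_set_scope.
Local Open Scope ring_scope.
Local Open Scope complex_scope.

(** * Integration on [0, a] *)

Lemma lebesgue_aeS (R : realType) (P Q : R -> Prop) : (forall x, P x -> Q x) ->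
  {ae @lebesgue_measure R, forall x, P x} -> {ae @lebesgue_measure R, forall x, Q x}.
Proof. exact: (@filterS _ _ (ae_filter_ringOfSetsType lebesgue_measure)). Qed.

Lemma lebesgue_aeI (R : realType) (P Q : R -> Prop) :
  {ae @lebesgue_measure R, forall x, P x} -> {ae @lebesgue_measure R, forall x, Q x} ->
  {ae @lebesgue_measure R, forall x, P x /\ Q x}.
Proof. exact: (@filterI _ _ (ae_filter_ringOfSetsType (@lebesgue_measure R))). Qed.

Section Integral.
Variables (R : realType) (a : R).
Notation mu := (@lebesgue_measure R).

Definition integrable_itv (f : R -> R) := mu.-integrable `[0, a] (EFin \o f).

Definition itvint (f : R -> R) (x y : R) : R := \int[mu]_(t in `[x, y]) f t.

Lemma integrable_itvW f x y : 0 <= x -> y <= a -> integrable_itv f ->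
  mu.-integrable `[x, y] (EFin \o f).
Proof.
move=> x0 ya; apply: integrableS => //.
by apply: subset_itv; rewrite bnd_simp.
Qed.

Lemma itv_finite : (mu `[0%R, a] < +oo)%E.
Proof. by rewrite lebesgue_measure_itv /= lte_fin; case: ifP => _; rewrite ?ltry. Qed.

Lemma bounded_integrable_itv (f : R -> R) (M : R) : measurable_fun `[0, a] f ->
  (forall x, 0 <= x <= a -> `|f x| <= M) -> integrable_itv f.
Proof.
move=> mf fM; apply: measurable_bounded_integrable => //; first exact: itv_finite.
exists M; split; rewrite ?num_real // => z Mz x /=; rewrite in_itv /= => xa.
exact: le_trans (fM x xa) (ltW Mz).
Qed.

Lemma integrable_itv_cst (c : R) : integrable_itv (fun=> c).
Proof.
by apply: (@bounded_integrable_itv _ `|c|) => [|x _]; [exact: measurable_cst|].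
Qed.

Lemma integrable_itvD (f g : R -> R) : integrable_itv f -> integrable_itv g ->
  integrable_itv (fun x => f x + g x).
Proof. by move=> fi gi; have := integrableD _ fi gi; apply. Qed.

Lemma integrable_itvZ c f : integrable_itv f -> integrable_itv (fun x => c * f x).
Proof. by move=> fi; have := integrableZl _ c fi; apply. Qed.

Lemma integrable_itv_norm f : integrable_itv f -> integrable_itv (fun x => `|f x|).
Proof. by move=> fi; apply: integrable_norm. Qed.

Lemma integrable_itvM (f g : R -> R) (M : R) : measurable_fun `[0, a] f ->
  (forall x, 0 <= x <= a -> `|f x| <= M) -> integrable_itv g ->
  integrable_itv (fun x => f x * g x).
Proof.
move=> mf fM gi; have := @integrableMr _ _ R mu `[0, a] _ f (EFin \o g) mf _ gi.
apply=> //; exists M; split; rewrite ?num_real // => z Mz x /=; rewrite in_itv /= => xa.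
exact: le_trans (fM x xa) (ltW Mz).
Qed.

Section Sub.
Variables x y : R.
Hypotheses (x0 : 0 <= x) (ya : y <= a).

Lemma itvintD f g : integrable_itv f -> integrable_itv g ->
  itvint (fun t => f t + g t) x y = itvint f x y + itvint g x y.
Proof. by move=> fi gi; apply: RintegralD; rewrite //; apply: integrable_itvW. Qed.

Lemma itvintZ c f : integrable_itv f -> itvint (fun t => c * f t) x y = c * itvint f x y.
Proof. by move=> fi; apply: RintegralZl; rewrite //; apply: integrable_itvW. Qed.

Lemma le_itvint f g : integrable_itv f -> integrable_itv g ->
  (forall t, x <= t <= y -> f t <= g t) -> itvint f x y <= itvint g x y.
Proof.
move=> fi gi fg; apply: le_Rintegral; rewrite //; exact: integrable_itvW.
Qed.

Lemma norm_itvint f : integrable_itv f -> `|itvint f x y| <= itvint (fun t => `|f t|) x y.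
Proof. by move=> fi; apply: le_normr_Rintegral; rewrite //; apply: integrable_itvW. Qed.

Lemma itvint_cst c : x <= y -> itvint (fun=> c) x y = c * (y - x).
Proof.
move=> xy; transitivity (c * fine (mu `[x, y])); first exact: Rintegral_cst.
rewrite lebesgue_measure_itv /= lte_fin.
move: xy; rewrite le_eqVlt => /predU1P[->|xy]; first by rewrite ltxx subrr.
by rewrite xy.
Qed.

Lemma itvint_cat f z : integrable_itv f -> x <= z <= y ->
  itvint f x y = itvint f x z + itvint f z y.
Proof.
move=> fi /andP[xz zy]; have fxy := integrable_itvW x0 ya fi.
have zy' : mu.-integrable `]z, y] (EFin \o f).
  by apply: integrableS fxy => //; apply: subset_itv; rewrite ?bnd_simp.
have E1 : itvint f x y - itvint f x z = \int[mu]_(t in `]z, y]) f t.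
  by apply: Rintegral_itvB; rewrite ?bnd_simp.
have E2 : \int[mu]_(t in `]z, y]) f t = itvint f z y.
  exact: Rintegral_itv_obnd_cbnd.
by rewrite -E2 -E1 addrC subrK.
Qed.

Lemma itvint_ae f g : integrable_itv f -> integrable_itv g ->
  {ae mu, forall t, t \in `[0, a] -> f t = g t} -> itvint f x y = itvint g x y.
Proof.
move=> fi gi fg; congr fine; apply: ae_eq_integral => //.
- exact: measurable_int (integrable_itvW x0 ya fi).
- exact: measurable_int (integrable_itvW x0 ya gi).
apply: lebesgue_aeS fg => t fg /=; rewrite in_itv /= => /andP[xt ty].
have ta : t \in `[0, a] by rewrite in_itv /= (le_trans x0 xt) (le_trans ty ya).
by rewrite fg.
Qed.

End Sub.

Lemma itvint0 f x : itvint f x x = 0.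
Proof. by rewrite /itvint set_itv1 Rintegral_set1. Qed.

Lemma itvint_ge0 f x y : (forall t, x <= t <= y -> 0 <= f t) -> 0 <= itvint f x y.
Proof. by move=> f0; apply: Rintegral_ge0 => t /=; rewrite in_itv; apply: f0. Qed.

Lemma eq_itvint f g x y : (forall t, x <= t <= y -> f t = g t) ->
  itvint f x y = itvint g x y.
Proof.
by move=> fg; apply: eq_Rintegral => t; rewrite inE /= in_itv /=; apply: fg.
Qed.

End Integral.

(** * Change of variables under x |-> a - x *)

Section Reflection.
Variables (R : realType) (a : R).
Notation mu := (@lebesgue_measure R).

Definition reflect_at (t : R) : R := a - t.

Lemma measurable_reflect_at (D : set R) : measurable_fun D reflect_at.
Proof.
by apply: measurable_funB; [exact: measurable_cst|exact: measurable_id].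
Qed.

Lemma reflect_atK : involutive reflect_at.
Proof. by move=> t; rewrite /reflect_at subKr. Qed.

(** By uniqueness of Lebesgue measure it is enough to compare the two measures on intervals ]x, y],
    whose preimages are [a - y, a - x[. *)
Lemma lebesgue_measure_reflect (A : set R) : measurable A ->
  mu (reflect_at @^-1` A) = mu A.
Proof.
move=> mA; rewrite -[LHS]/(pushforward mu (reflect_at : _ -> measurableTypeR R) A).
apply/esym/lebesgue_measure_unique => //; first exact: measurable_reflect_at.
move=> mf _ [[x y]] _ <-.
have -> : mu `]x, y] = mu `[(a - y), (a - x)[.
  rewrite !lebesgue_measure_itv /= !lte_fin ltrD2l ltrN2.
  by case: ifP => // _; rewrite -!EFinD; congr EFin; ring.
rewrite /pushforward; congr (lebesgue_measure _); apply/seteqP; split => t /=;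
  rewrite !in_itv /= /reflect_at; lra.
Qed.

Lemma ae_reflect (P : R -> Prop) : {ae mu, forall x, P x} ->
  {ae mu, forall x, P (reflect_at x)}.
Proof.
move=> [N [mN N0 PN]]; exists (reflect_at @^-1` N); split.
- by rewrite -[X in measurable X]setTI; apply: measurable_reflect_at.
- by rewrite lebesgue_measure_reflect.
- by move=> x /= Px; apply: PN.
Qed.

Lemma reflect_itv x y : reflect_at @^-1` `[x, y]%classic = `[reflect_at y, reflect_at
  x]%classic.
Proof.
by apply/seteqP; split => t /=; rewrite !in_itv /= /reflect_at; lra.
Qed.

Lemma ge0_integral_reflect (f : R -> \bar R) (x y : R) :
  measurable_fun `[x, y] f -> (forall t, 0 <= f t)%E ->
  (\int[mu]_(t in `[reflect_at y, reflect_at x]) f (reflect_at t) =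
   \int[mu]_(t in `[x, y]) f t)%E.
Proof.
move=> mf f0; rewrite -reflect_itv.
rewrite -[_ @^-1` _]/((reflect_at : _ -> measurableTypeR R) @^-1` `[x, y]).
rewrite -ge0_integral_pushforward //=; last exact: measurable_reflect_at.
apply: eq_measure_integral => //=; first exact: measurable_reflect_at.
by move=> _ A mA _; exact: lebesgue_measure_reflect.
Qed.

Lemma measurable_fun_reflect (f : R -> R) (x y : R) : measurable_fun `[x, y] f ->
  measurable_fun `[reflect_at y, reflect_at x] (f \o reflect_at).
Proof.
move=> mf; apply: (@measurable_comp _ _ _ _ _ _ `[x, y]) => //.
  by move=> _ [t + <-]; rewrite -reflect_itv.
exact: measurable_reflect_at.
Qed.

Lemma integrable_reflect (f : R -> R) (x y : R) :
  mu.-integrable `[x, y] (EFin \o f) ->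
  mu.-integrable `[reflect_at y, reflect_at x] (EFin \o (f \o reflect_at)).
Proof.
move=> /integrableP[mf fi]; apply/integrableP; split.
  by apply/measurable_EFinP; apply: measurable_fun_reflect; apply/measurable_EFinP.
rewrite (@ge0_integral_reflect (fun t => `|(EFin \o f) t|%E)) //.
exact: measurableT_comp.
Qed.

Lemma Rintegral_reflect (f : R -> R) (x y : R) :
  mu.-integrable `[x, y] (EFin \o f) ->
  \int[mu]_(t in `[reflect_at y, reflect_at x]) f (reflect_at t) =
  \int[mu]_(t in `[x, y]) f t.
Proof.
move=> fi; congr fine; have [mf _] := integrableP _ _ _ fi.
rewrite integralE [RHS]integralE; congr (_ - _)%E.
  rewrite -(@ge0_integral_reflect ((EFin \o f)^\+)%E x y) //; last first.
    exact: measurable_funepos.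
  by apply: eq_integral => t _; rewrite !funeposE.
rewrite -(@ge0_integral_reflect ((EFin \o f)^\-)%E x y) //; last first.
  exact: measurable_funeneg.
by apply: eq_integral => t _; rewrite !funenegE.
Qed.

End Reflection.

(* Subdividing [0, x] into n parts bounds D x - D 0 by K x (H x - H 0) / n. *)
Lemma superlinear_increment_cst (R : realType) (a K : R) (D H : R -> R) :
  (forall x y, 0 <= x -> x <= y -> y <= a ->
    `|D y - D x| <= K * (y - x) * (H y - H x)) ->
  forall x, 0 <= x <= a -> D x = D 0.
Proof.
move=> DH x /andP[x0 xa]; apply/eqP; rewrite -subr_eq0 -normr_eq0; apply/eqP.
set c := K * x * (H x - H 0).
have bnd n : n.+1%:R * `|D x - D 0| <= c.
  pose p (i : nat) := x * (i%:R / n.+1%:R).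
  have n0 : (n.+1%:R : R) != 0 by rewrite pnatr_eq0.
  have p0 : p 0%N = 0 by rewrite /p mul0r mulr0.
  have pn : p n.+1 = x by rewrite /p divff ?mulr1.
  have tel (F : R -> R) : \sum_(0 <= i < n.+1) (F (p i.+1) - F (p i)) = F x - F 0.
    by rewrite (telescope_sumr (fun i => F (p i))) // pn p0.
  have le_p i : (i <= n.+1)%N -> 0 <= p i <= a.
    move=> i_n; rewrite /p mulr_ge0 ?divr_ge0 ?ler0n //=.
    rewrite (le_trans _ xa) // ler_piMr // ler_pdivrMr ?ltr0n // mul1r ler_nat //.
  have step i : p i.+1 - p i = x / n.+1%:R.
    by rewrite /p -mulrBr -mulrBl -natrB // subSnn mul1r.
  rewrite -tel; apply: le_trans (ler_wpM2l _ (ler_norm_sum _ _ _)) _; rewrite ?ler0n //.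
  apply: le_trans (_ : n.+1%:R * \sum_(0 <= i < n.+1)
    K * (x / n.+1%:R) * (H (p i.+1) - H (p i)) <= _).
    apply: ler_wpM2l; rewrite ?ler0n // big_nat [leRHS]big_nat; apply: ler_sum => i /= i_n.
    have /andP[l1 l2] := le_p i (ltnW i_n); have /andP[l3 l4] := le_p i.+1 i_n.
    have := DH (p i) (p i.+1) l1 _ l4; rewrite step; apply.
    by rewrite -subr_ge0 step divr_ge0.
  rewrite -mulr_sumr tel /c le_eqVlt; apply/orP; left; apply/eqP.
  by rewrite !mulrA; congr (_ * _); field.
exact: bounded_multiples_eq0 bnd.
Qed.

(** * Absolutely continuous functions and the product rule *)

Section AbsoluteContinuity.
Variables (R : realType) (a : R).
Hypothesis a_gt0 : 0 < a.
Notation mu := (@lebesgue_measure R).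

Let a_ge0 : 0 <= a. Proof. exact: ltW. Qed.

(** Absolute continuity on [0, a] in integrated form; [f1] is a representative of the derivative. *)
Definition primitive (f f1 : R -> R) :=
  integrable_itv a f1 /\ forall x, 0 <= x <= a -> f x = f 0 + itvint f1 0 x.

Lemma primitive_sub f f1 x y : primitive f f1 -> 0 <= x -> x <= y -> y <= a ->
  f y - f x = itvint f1 x y.
Proof.
move=> [f1i fE] x0 xy ya.
have xa := le_trans xy ya; have y0 := le_trans x0 xy.
rewrite (fE y) ?y0 // (fE x) ?x0 // (@itvint_cat _ a _ _ (lexx 0) ya _ x) ?x0 //; ring.
Qed.

Lemma primitive_continuous f f1 : primitive f f1 -> {within `[0, a], continuous f}.
Proof.
move=> [f1i fE].
apply: (@subspace_eq_continuous _ _ _ (fun x => f 0 + itvint f1 0 x)).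
  by move=> x; rewrite inE /= in_itv /= => /fE.
move=> x; apply: cvgD; first exact: cvg_cst.
exact: (parameterized_integral_continuous a_ge0 f1i).
Qed.

Lemma primitive_measurable f f1 : primitive f f1 -> measurable_fun `[0, a] f.
Proof.
move=> /primitive_continuous; apply: subspace_continuous_measurable_fun.
exact: measurable_itv.
Qed.

Lemma primitive_bounded f f1 : primitive f f1 ->
  exists M, forall x, 0 <= x <= a -> `|f x| <= M.
Proof.
move=> pf; have [f1i fE] := pf; have f1n := integrable_itv_norm f1i.
exists (`|f 0| + itvint (fun t => `|f1 t|) 0 a) => x /andP[x0 xa].
rewrite (fE x) ?x0 //; apply: le_trans (ler_normD _ _) _; rewrite lerD2l.
apply: le_trans (norm_itvint (lexx 0) xa f1i) _.
by rewrite [leRHS](@itvint_cat _ a _ _ (lexx 0) (lexx a) _ x) ?x0 // lerDl itvint_ge0.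
Qed.

Lemma primitive_integrable f f1 : primitive f f1 -> integrable_itv a f.
Proof.
move=> pf; have [M fM] := primitive_bounded pf.
exact: bounded_integrable_itv (primitive_measurable pf) fM.
Qed.

Lemma primitive_integrableM f f1 g : primitive f f1 -> integrable_itv a g ->
  integrable_itv a (fun x => f x * g x).
Proof.
move=> pf gi; have [M fM] := primitive_bounded pf.
exact: integrable_itvM (primitive_measurable pf) fM gi.
Qed.

(** Let D be the product minus the integral of its expected derivative. Its increment over [x, y] is
    at most 2 M (y - x) times the integral of |g1| over [x, y], so D is constant by
    [superlinear_increment_cst]. *)
Lemma primitive_mul f f1 g g1 M : primitive f f1 -> primitive g g1 ->
  (forall x, 0 <= x <= a -> `|f1 x| <= M) ->
  primitive (fun x => f x * g x) (fun x => g x * f1 x + f x * g1 x).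
Proof.
move=> pf pg f1M; have [f1i _] := pf; have [g1i _] := pg.
have gf := primitive_integrableM pg f1i; have fg := primitive_integrableM pf g1i.
have hi := integrable_itvD gf fg; split => // x xa.
have M0 : 0 <= M by apply: le_trans (f1M 0 _); rewrite ?normr_ge0 ?lexx.
have g1n := integrable_itv_norm g1i.
pose D y := f y * g y - itvint (fun x => g x * f1 x + f x * g1 x) 0 y.
pose H y := itvint (fun t => `|g1 t|) 0 y.
suff /(_ x xa) : forall x, 0 <= x <= a -> D x = D 0.
  by rewrite /D itvint0 subr0 => <-; rewrite subrK.
apply: (@superlinear_increment_cst _ a (2 * M) D H) => {xa}x y x0 xy ya.
have xa := le_trans xy ya; have y0 := le_trans x0 xy.
have HE : H y - H x = itvint (fun t => `|g1 t|) x y.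
  by rewrite /H (@itvint_cat _ a _ _ (lexx 0) ya _ x) ?x0 // addrAC subrr add0r.
rewrite HE; set G := itvint _ x y.
(* The increment of f g is f(y) (g(y) - g(x)) + g(x) (f(y) - f(x)), so freezing f at y and g at x
   writes the increment of D as one integral. *)
pose h t := (f y * g1 t + g x * f1 t) + (-1) * (g t * f1 t + f t * g1 t).
have DE : D y - D x = itvint h x y.
  have i1 := integrable_itvZ (f y) g1i; have i2 := integrable_itvZ (g x) f1i.
  rewrite /h (itvintD x0 ya (integrable_itvD i1 i2) (integrable_itvZ _ hi)).
  rewrite (itvintZ x0 ya _ hi) (itvintD x0 ya i1 i2) (itvintZ x0 ya _ g1i).
  rewrite (itvintZ x0 ya _ f1i) -(primitive_sub pf) // -(primitive_sub pg) // /D.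
  rewrite (@itvint_cat _ a 0 y (lexx 0) ya _ x hi) ?x0 //; ring.
have hi' : integrable_itv a h.
  apply: integrable_itvD; last exact: integrable_itvZ.
  by apply: integrable_itvD; apply: integrable_itvZ.
rewrite DE; apply: le_trans (norm_itvint x0 ya hi') _.
apply: le_trans (_ : itvint (fun t => M * (y - x) * `|g1 t| + M * G) x y <= _).
  apply: (le_itvint x0 ya); first exact: integrable_itv_norm.
    by apply: integrable_itvD; [apply: integrable_itvZ | apply: integrable_itv_cst].
  move=> t /andP[xt ty]; have t0 := le_trans x0 xt; have ta := le_trans ty ya.
  have -> : h t = (f y - f t) * g1 t + (g x - g t) * f1 t by rewrite /h; ring.
  apply: le_trans (ler_normD _ _) _; rewrite !normrM; apply: lerD.
    apply: ler_wpM2r => //; rewrite (primitive_sub pf) //.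
    apply: le_trans (norm_itvint t0 ya f1i) _.
    apply: le_trans (_ : itvint (fun=> M) t y <= _).
      apply: (le_itvint t0 ya); [exact: integrable_itv_norm|exact: integrable_itv_cst|].
      by move=> s /andP[ts sy]; rewrite f1M // (le_trans t0 ts) (le_trans sy ya).
    by rewrite itvint_cst // ler_wpM2l // lerB.
  rewrite mulrC; apply: ler_pM => //; first by rewrite f1M ?t0.
  rewrite distrC (primitive_sub pg) //; apply: le_trans (norm_itvint x0 ta g1i) _.
  by rewrite /G (@itvint_cat _ a _ _ x0 ya _ t) ?xt // lerDl itvint_ge0.
rewrite (itvintD x0 ya (integrable_itvZ _ g1n) (integrable_itv_cst _ _)).
rewrite (itvintZ x0 ya _ g1n) itvint_cst //.
by rewrite -/G le_eqVlt; apply/orP; left; apply/eqP; ring.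
Qed.

Lemma primitive_comb f f1 g g1 c d : primitive f f1 -> primitive g g1 ->
  primitive (fun x => c * f x + d * g x) (fun x => c * f1 x + d * g1 x).
Proof.
move=> [f1i fE] [g1i gE].
have ci := integrable_itvZ c f1i; have di := integrable_itvZ d g1i.
split; first exact: integrable_itvD.
move=> x /andP[x0 xa];
  rewrite (itvintD _ _ ci di) // (itvintZ _ _ _ f1i) // (itvintZ _ _ _ g1i) //.
rewrite (fE x) ?x0 // (gE x) ?x0 //; ring.
Qed.

Lemma primitive_ae_cst f f1 : primitive f f1 ->
  {ae mu, forall x, x \in `[0, a] -> f1 x = 0} -> forall x, 0 <= x <= a -> f x = f 0.
Proof.
move=> [f1i fE] f10 x /andP[x0 xa]; rewrite (fE x) ?x0 //.
rewrite (@itvint_ae _ a _ _ (lexx 0) xa _ (fun=> 0) f1i (integrable_itv_cst _ _) f10).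
by rewrite itvint_cst // mul0r addr0.
Qed.

Lemma primitive_reflect f f1 : primitive f f1 ->
  primitive (fun x => f (reflect_at a x)) (fun x => - f1 (reflect_at a x)).
Proof.
move=> pf; have [f1i fE] := pf.
have r0 : reflect_at a 0 = a by rewrite /reflect_at subr0.
have ra : reflect_at a a = 0 by rewrite /reflect_at subrr.
have ri : integrable_itv a (fun x => f1 (reflect_at a x)).
  by have := integrable_reflect a f1i; rewrite r0 ra.
have ri' : integrable_itv a (fun x => - f1 (reflect_at a x)).
  by have := integrable_itvZ (-1) ri; under eq_fun do rewrite mulN1r.
split => // x /andP[x0 xa].
have rx : 0 <= reflect_at a x by rewrite /reflect_at subr_ge0.
have -> : itvint (fun x => - f1 (reflect_at a x)) 0 x
    = - itvint (fun x => f1 (reflect_at a x)) 0 x.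
  by rewrite -mulN1r -(@itvintZ _ a) //; apply: eq_itvint => t _; rewrite mulN1r.
rewrite r0; have fi : mu.-integrable `[reflect_at a x, a] (EFin \o f1).
  by apply: (@integrable_itvW _ a).
have := Rintegral_reflect a fi; rewrite ra reflect_atK -/(itvint _ 0 x) => ->.
rewrite -/(itvint _ _ _) -(primitive_sub pf) //; first by ring.
by rewrite /reflect_at gerBl.
Qed.

End AbsoluteContinuity.

(** * Solutions of the edge equation *)

Section Sobolev.
Variables (R : realType) (a : R).
Hypothesis a_gt0 : 0 < a.
Notation mu := (@lebesgue_measure R).

(** Pointwise |f| <= 1 + f^2, and the interval has finite measure. *)
Lemma L2_integrable f : L2 a f -> integrable_itv a f.
Proof.
move=> [mf fi]; have gi := integrable_itvD (integrable_itv_cst a 1) fi.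
apply: (le_integrable _ _ _ gi) => //; first exact/measurable_EFinP.
move=> x _ /=; rewrite lee_fin [leRHS]ger0_norm ?addr_ge0 ?sqr_ge0 //.
rewrite -real_normK ?num_real //; have := sqr_ge0 (`|f x| - 1); have := normr_ge0 (f x).
nra.
Qed.

Lemma L2_comb f g c d : L2 a f -> L2 a g -> L2 a (fun x => c * f x + d * g x).
Proof.
move=> [mf fi] [mg gi].
have mh : measurable_fun `[0, a] (fun x => c * f x + d * g x).
  by apply: measurable_funD; apply: measurable_funM => //; exact: measurable_cst.
split=> //; have hi := integrable_itvD (integrable_itvZ (2 * c ^+ 2) fi)
  (integrable_itvZ (2 * d ^+ 2) gi).
apply: (le_integrable _ _ _ hi) => //; first exact/measurable_EFinP/measurable_funX.
move=> x _ /=; rewrite lee_fin !ger0_norm ?sqr_ge0 //; last first.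
  by rewrite addr_ge0 // mulr_ge0 ?sqr_ge0 // mulr_ge0 ?sqr_ge0.
have := sqr_ge0 (c * f x - d * g x); nra.
Qed.

Lemma L2_reflect f : L2 a f -> L2 a (fun x => f (reflect_at a x)).
Proof.
move=> [mf fi]; have r0 : reflect_at a 0 = a by rewrite /reflect_at subr0.
have ra : reflect_at a a = 0 by rewrite /reflect_at subrr.
by split; [have := measurable_fun_reflect (a := a) mf | have := integrable_reflect a fi];
  rewrite r0 ra.
Qed.

(** Integrability of [y2] comes from L^2, and that of [y1] from its being a primitive of [y2], hence
    bounded and measurable. *)
Lemma H2_primitive y y1 y2 :
  H2 a y y1 y2 <-> [/\ L2 a y2, primitive a y y1 & primitive a y1 y2].
Proof.
split=> [[y2L [yE y1E]]|[y2L [_ yE] [_ y1E]]]; last by split.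
have p1 : primitive a y1 y2 by split=> //; exact: L2_integrable.
by split=> //; split=> //; exact: primitive_integrable p1.
Qed.

Lemma H2_comb f f1 f2 g g1 g2 c d : H2 a f f1 f2 -> H2 a g g1 g2 ->
  H2 a (fun x => c * f x + d * g x) (fun x => c * f1 x + d * g1 x)
    (fun x => c * f2 x + d * g2 x).
Proof.
move=> /H2_primitive[l p p1] /H2_primitive[l' p' p1']; apply/H2_primitive; split.
- exact: L2_comb.
- exact: primitive_comb.
- exact: primitive_comb.
Qed.

Lemma H2_reflect f f1 f2 : H2 a f f1 f2 ->
  H2 a (fun x => f (reflect_at a x)) (fun x => - f1 (reflect_at a x))
    (fun x => f2 (reflect_at a x)).
Proof.
move=> /H2_primitive[l p p1]; apply/H2_primitive; split.
- exact: L2_reflect.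
- exact: primitive_reflect.
- have p1r := primitive_reflect p1.
  have := primitive_comb (-1) 0 p1r p1r.
  by under eq_fun do rewrite mul0r addr0 mulN1r;
     under [X in primitive _ _ X]eq_fun do rewrite mul0r addr0 mulN1r opprK.
Qed.

Lemma primitive_ae f f1 g : primitive a f f1 -> integrable_itv a g ->
  {ae mu, forall x, x \in `[0, a] -> f1 x = g x} -> primitive a f g.
Proof.
move=> [f1i fE] gi fg; split=> // x /andP[x0 xa]; rewrite (fE x) ?x0 //.
by rewrite (itvint_ae (lexx 0) xa f1i gi fg).
Qed.

End Sobolev.

Section Solutions.
Variables (R : realType) (a : R) (q : R -> R) (al be : R).
Hypothesis a_gt0 : 0 < a.
Hypothesis q_L2 : L2 a q.
Notation mu := (@lebesgue_measure R).

(** Complex form of the coupled real system [ode]; [Y1] and [Y2] stand for Y' and Y''. *)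
Definition solution (Y Y1 Y2 : R -> R[i]) : Prop :=
  [/\ H2 a (fun x => Re (Y x)) (fun x => Re (Y1 x)) (fun x => Re (Y2 x)),
      H2 a (fun x => Im (Y x)) (fun x => Im (Y1 x)) (fun x => Im (Y2 x)) &
      ode a q al be (fun x => Re (Y x)) (fun x => Re (Y2 x))
        (fun x => Im (Y x)) (fun x => Im (Y2 x))].

Lemma solution_comb (c d : R[i]) Y Y1 Y2 Z Z1 Z2 :
  solution Y Y1 Y2 -> solution Z Z1 Z2 ->
  solution (fun x => c * Y x + d * Z x) (fun x => c * Y1 x + d * Z1 x)
    (fun x => c * Y2 x + d * Z2 x).
Proof.
(* The factors 1 put the real part in the shape of two nested uses of [H2_comb]; likewise for the
   imaginary part below. *)
have ReE (A B : R -> R[i]) : (fun x => Re (c * A x + d * B x)) =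
   (fun x => 1 * (Re c * Re (A x) + (- Im c) * Im (A x))
           + 1 * (Re d * Re (B x) + (- Im d) * Im (B x))).
  apply/funext => x; case: c d (A x) (B x) => [c1 c2] [d1 d2] [x1 x2] [y1 y2] /=; ring.
have ImE (A B : R -> R[i]) : (fun x => Im (c * A x + d * B x)) =
   (fun x => 1 * (Re c * Im (A x) + Im c * Re (A x))
           + 1 * (Re d * Im (B x) + Im d * Re (B x))).
  clear ReE; apply/funext => x;
    case: c d (A x) (B x) => [c1 c2] [d1 d2] [x1 x2] [y1 y2] /=; ring.
move=> [HYr HYi OY] [HZr HZi OZ]; split; cbv beta.
- by rewrite !ReE; apply: H2_comb => //; apply: H2_comb.
- by rewrite !ImE; apply: H2_comb => //; apply: H2_comb.
rewrite !ReE !ImE; apply: lebesgue_aeS (lebesgue_aeI OY OZ) => x [OYx OZx] xa.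
have [Yr Yi] := OYx xa; have [Zr Zi] := OZx xa; move: Yr Yi Zr Zi.
move: (Re (Y x)) (Im (Y x)) (Re (Z x)) (Im (Z x)).
move: (Re (Y2 x)) (Im (Y2 x)) (Re (Z2 x)) (Im (Z2 x)).
move=> Yr2 Yi2 Zr2 Zi2 Yr Yi Zr Zi E1 E2 E3 E4.
have {}E1 : Yr2 = q x * Yr - (al * Yr - be * Yi) by rewrite -E1; ring.
have {}E2 : Yi2 = q x * Yi - (be * Yr + al * Yi) by rewrite -E2; ring.
have {}E3 : Zr2 = q x * Zr - (al * Zr - be * Zi) by rewrite -E3; ring.
have {}E4 : Zi2 = q x * Zi - (be * Zr + al * Zi) by rewrite -E4; ring.
by rewrite E1 E2 E3 E4; split; ring.
Qed.

Lemma solutionZ (c : R[i]) Y Y1 Y2 : solution Y Y1 Y2 ->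
  solution (fun x => c * Y x) (fun x => c * Y1 x) (fun x => c * Y2 x).
Proof.
move=> sY; have := solution_comb c 0 sY sY.
have E (A : R -> R[i]) : (fun x => c * A x + 0 * A x) = (fun x => c * A x).
  by apply/funext => x; rewrite mul0r addr0.
by rewrite !E.
Qed.

Lemma solution_reflect Y Y1 Y2 :
  {ae mu, forall x, x \in `[0, a] -> q x = q (a - x)} -> solution Y Y1 Y2 ->
  solution (fun x => Y (reflect_at a x)) (fun x => - Y1 (reflect_at a x))
    (fun x => Y2 (reflect_at a x)).
Proof.
move=> q_even [HYr HYi OY]; split.
- have -> : (fun x => Re (- Y1 (reflect_at a x))) = (fun x => - Re (Y1 (reflect_at a x))).
    by apply/funext => x; case: (Y1 _).
  exact: (H2_reflect a_gt0 HYr).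
- have -> : (fun x => Im (- Y1 (reflect_at a x))) = (fun x => - Im (Y1 (reflect_at a x))).
    by apply/funext => x; case: (Y1 _).
  exact: (H2_reflect a_gt0 HYi).
have OYr := ae_reflect a OY.
apply: lebesgue_aeS (lebesgue_aeI OYr q_even) => x [H qx] xa; rewrite (qx xa).
by apply: H; move: xa; rewrite !in_itv /= /reflect_at; lra.
Qed.

(** Under the integral Y'' may be replaced by (q - lam) Y, equal to it almost everywhere. With this
    representative the equation holds at every point. *)
Lemma solution_primitive Y Y1 Y2 : solution Y Y1 Y2 ->
  [/\ primitive a (fun x => Re (Y x)) (fun x => Re (Y1 x)),
      primitive a (fun x => Im (Y x)) (fun x => Im (Y1 x)),
      primitive a (fun x => Re (Y1 x))
        (fun x => Re (Y x) * q x + (- al * Re (Y x) + be * Im (Y x))) &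
      primitive a (fun x => Im (Y1 x))
        (fun x => Im (Y x) * q x + (- al * Im (Y x) + - be * Re (Y x)))].
Proof.
move=> [/(H2_primitive a_gt0)[l p p1] /(H2_primitive a_gt0)[l' p' p1'] O]; split=> //.
  apply: primitive_ae p1 _ _.
    apply: integrable_itvD; first exact: primitive_integrableM p (L2_integrable q_L2).
    by apply: integrable_itvD; apply: integrable_itvZ; apply: primitive_integrable;
      eassumption.
  by apply: lebesgue_aeS O => x /[apply] -[E _]; lra.
apply: primitive_ae p1' _ _.
  apply: integrable_itvD; first exact: primitive_integrableM p' (L2_integrable q_L2).
  by apply: integrable_itvD; apply: integrable_itvZ; apply: primitive_integrable;
    eassumption.
by apply: lebesgue_aeS O => x /[apply] -[_ E]; lra.
Qed.

Lemma primitive0_cst f f1 : primitive a f f1 -> (forall x, f1 x = 0) ->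
  forall x, 0 <= x <= a -> f x = f 0.
Proof. by move=> p f0; apply: (primitive_ae_cst p); apply: aeW => x _. Qed.

Lemma wronskian_primitive f f1 f2 g g1 g2 :
  primitive a f f1 -> primitive a f1 f2 -> primitive a g g1 -> primitive a g1 g2 ->
  primitive a (fun x => 1 * (f x * g1 x) + (-1) * (g x * f1 x))
    (fun x => 1 * (g1 x * f1 x + f x * g2 x) + (-1) * (f1 x * g1 x + g x * f2 x)).
Proof.
move=> p p1 p' p1'.
have [M fM] := primitive_bounded p1; have [M' gM] := primitive_bounded p1'.
exact: primitive_comb (primitive_mul a_gt0 p p1' fM) (primitive_mul a_gt0 p' p1 gM).
Qed.

(** The derivative Y Z'' - Z Y'' vanishes because both second derivatives are (q - lam) times the
    function. The real and imaginary parts are combinations of four real Wronskians. *)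
Lemma wronskian_cst Y Y1 Y2 Z Z1 Z2 : solution Y Y1 Y2 -> solution Z Z1 Z2 ->
  forall x, 0 <= x <= a -> Y x * Z1 x - Z x * Y1 x = Y 0 * Z1 0 - Z 0 * Y1 0.
Proof.
move=> /solution_primitive[pr pi pr1 pi1] /solution_primitive[sr si sr1 si1] x xa.
have rr := wronskian_primitive pr pr1 sr sr1; have ii := wronskian_primitive pi pi1 si si1.
have ri := wronskian_primitive pr pr1 si si1; have ir := wronskian_primitive pi pi1 sr sr1.
have /primitive0_cst Er := primitive_comb 1 (-1) rr ii.
have /primitive0_cst Ei := primitive_comb 1 1 ri ir.
have {}Er := Er ltac:(by move=> ?; ring) x xa.
have {}Ei := Ei ltac:(by move=> ?; ring) x xa.
move: Er Ei; case: (Y x) (Y1 x) (Z x) (Z1 x) (Y 0) (Y1 0) (Z 0) (Z1 0)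
  => [u v] [u1 v1] [s t] [s1 t1] [u' v'] [u1' v1'] [s' t'] [s1' t1'] /= Er Ei.
by apply/eqP; rewrite eq_complex /=; apply/andP; split; apply/eqP; lra.
Qed.

End Solutions.

(** * Uniqueness for the initial value problem *)

Section Uniqueness.
Variables (R : realType) (a : R) (q : R -> R) (al be : R).
Hypothesis a_gt0 : 0 < a.
Hypothesis q_L2 : L2 a q.
Notation mu := (@lebesgue_measure R).

Lemma primitive_norm_le f f1 k c e x : primitive a f f1 -> f c = 0 ->
  0 <= c -> c <= x -> x <= e -> e <= a -> integrable_itv a k ->
  (forall t, c <= t <= e -> `|f1 t| <= k t) -> `|f x| <= itvint k c x.
Proof.
move=> pf fc c0 cx xe ea ki fk; have [f1i _] := pf; have xa := le_trans xe ea.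
rewrite -[f x]subr0 -fc (primitive_sub pf) //.
apply: le_trans (norm_itvint c0 xa f1i) _.
apply: (le_itvint c0 xa) => //; first exact: integrable_itv_norm.
by move=> t /andP[ct tx]; rewrite fk // ct (le_trans tx xe).
Qed.

(** [k] dominates the coefficient q - lam; [K] bounds its integral over any subinterval, and the
    added 1 makes it positive. *)
Let k x := `|q x| + (`|al| + `|be|).
Let K := itvint k 0 a + 1.

Let ki : integrable_itv a k.
Proof.
apply: integrable_itvD; first exact/integrable_itv_norm/L2_integrable.
exact: integrable_itv_cst.
Qed.

Let k_ge0 x : 0 <= k x. Proof. by rewrite /k !addr_ge0. Qed.

Let K_gt0 : 0 < K.
Proof. by rewrite /K ltr_wpDl // itvint_ge0. Qed.

Let le_K c x : 0 <= c -> c <= x -> x <= a -> itvint k c x <= K.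
Proof.
move=> c0 cx xa; have ca := le_trans cx xa; rewrite /K.
rewrite (@itvint_cat _ a 0 a (lexx 0) (lexx a) _ c) ?c0 //.
rewrite (@itvint_cat _ a c a c0 (lexx a) _ x) ?cx //.
have i1 : 0 <= itvint k 0 c by apply: itvint_ge0.
have i2 : 0 <= itvint k x a by apply: itvint_ge0.
lra.
Qed.

(** A bound B for |u| + |v| on [c, e] gives |u'|, |v'| <= K B, and integrating over a length of at
    most 1 / (4 K) gives |u|, |v| <= B / 4. The bound is thus halved indefinitely. *)
Lemma solution_vanish_step Y Y1 Y2 c e : solution a q al be Y Y1 Y2 ->
  0 <= c -> e <= a -> (e - c) * (4 * K) <= 1 -> Y c = 0 -> Y1 c = 0 ->
  forall x, c <= x <= e -> Y x = 0 /\ Y1 x = 0.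
Proof.
move=> /(solution_primitive a_gt0 q_L2)[pu pv pu1 pv1] c0 ea ec Yc Y1c.
have Yc' : Re (Y c) = 0 /\ Im (Y c) = 0 by rewrite Yc.
have Y1c' : Re (Y1 c) = 0 /\ Im (Y1 c) = 0 by rewrite Y1c.
case: Yc' Y1c' => uc vc [u1c v1c].
set u := fun x => Re (Y x) in pu uc *; set v := fun x => Im (Y x) in pv vc *.
set u1 := fun x => Re (Y1 x) in pu pu1 u1c *; set v1 := fun x => Im (Y1 x) in pv pv1 v1c *.
pose m x := `|u x| + `|v x|.
have halve B : (forall x, c <= x <= e -> m x <= B) -> forall x, c <= x <= e ->
    [/\ `|u1 x| <= K * B, `|v1 x| <= K * B & m x <= B / 2].
  move=> mB; have kB := integrable_itvZ B ki.
  have bnd1 w w1 : primitive a w w1 -> w c = 0 ->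
      (forall t, c <= t <= e -> `|w1 t| <= B * k t) -> forall x, c <= x <= e -> `|w x|
        <= K * B.
    move=> pw wc w1k x /andP[cx xe]; have xa := le_trans xe ea.
    apply: le_trans (primitive_norm_le pw wc c0 cx xe ea kB w1k) _.
    rewrite (itvintZ c0 xa _ ki) mulrC ler_wpM2r ?le_K //.
    by apply: le_trans (mB x _); rewrite ?cx ?xe // /m addr_ge0.
  have u1B := bnd1 _ _ pu1 u1c; have v1B := bnd1 _ _ pv1 v1c.
  have {}u1B : forall x, c <= x <= e -> `|u1 x| <= K * B.
    apply: u1B => t tce; apply: le_trans (_ : m t * k t <= _); last first.
      by rewrite ler_wpM2r ?mB.
    rewrite /m /k -/(u t) -/(v t); apply: le_trans (ler_normD _ _) _.
    rewrite normrM; apply: le_trans (lerD (lexx _) (ler_normD _ _)) _.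
    rewrite !normrM normrN.
    have := normr_ge0 (q t); have := normr_ge0 al; have := normr_ge0 be.
    have := normr_ge0 (u t); have := normr_ge0 (v t); nra.
  have {}v1B : forall x, c <= x <= e -> `|v1 x| <= K * B.
    apply: v1B => t tce; apply: le_trans (_ : m t * k t <= _); last first.
      by rewrite ler_wpM2r ?mB.
    rewrite /m /k -/(u t) -/(v t); apply: le_trans (ler_normD _ _) _.
    rewrite normrM; apply: le_trans (lerD (lexx _) (ler_normD _ _)) _.
    rewrite !normrM !normrN.
    have := normr_ge0 (q t); have := normr_ge0 al; have := normr_ge0 be.
    have := normr_ge0 (u t); have := normr_ge0 (v t); nra.
  move=> x xce; have [cx xe] := andP xce; split; [exact: u1B|exact: v1B|].
  have xa := le_trans xe ea.
  have B0 : 0 <= B by apply: le_trans (mB x xce); rewrite /m addr_ge0.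
  have bnd w w1 : primitive a w w1 -> w c = 0 ->
      (forall t, c <= t <= e -> `|w1 t| <= K * B) -> `|w x| <= B / 4.
    move=> pw wc w1K; have ci := integrable_itv_cst a (K * B).
    apply: le_trans (primitive_norm_le pw wc c0 cx xe ea ci w1K) _.
    rewrite itvint_cst //; have : (x - c) * (4 * K) <= 1.
      by apply: le_trans ec; rewrite ler_wpM2r ?lerB // mulr_ge0 // ltW.
    by nra.
  have := bnd _ _ pu uc u1B; have := bnd _ _ pv vc v1B; rewrite /m; lra.
have [Mu uM] := primitive_bounded pu; have [Mv vM] := primitive_bounded pv.
have mM n x : c <= x <= e -> m x <= (Mu + Mv) / 2 ^+ n.
  elim: n x => [|n IH] x xce.
    rewrite expr0 divr1 lerD ?uM ?vM //; move: xce => /andP[cx xe];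
      by rewrite (le_trans c0 cx) (le_trans xe ea).
  have [_ _] := halve _ IH x xce.
  by rewrite exprS invfM mulrCA mulrC mulrA.
have m0 x : c <= x <= e -> m x = 0.
  move=> xce; apply: (@bounded_multiples_eq0 _ _ (Mu + Mv)); first by rewrite /m addr_ge0.
  (* Since n + 1 <= 2^n, the geometric decay bounds all multiples of m x. *)
  move=> n; have := mM n x xce; rewrite ler_pdivlMr ?exprn_gt0 // mulrC; apply: le_trans.
  apply: ler_wpM2r; first by rewrite /m addr_ge0.
  by rewrite -natrX ler_nat ltn_expl.
have m0' x : c <= x <= e -> m x <= 0 by move=> /m0 ->.
(* The halving estimate with B = 0 yields the vanishing of Y' as well. *)
move=> x xce; have [] := halve 0 m0' x xce; rewrite mulr0 !normr_le0 => /eqP u10 /eqP v10 _.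
have := m0 x xce; rewrite /m => /eqP;
  rewrite paddr_eq0 // !normr_eq0 => /andP[/eqP u0 /eqP v0].
split; apply/eqP; rewrite eq_complex /= -?/(u x) -?/(v x) -?/(u1 x) -?/(v1 x).
  by rewrite u0 v0 !eqxx.
by rewrite u10 v10 !eqxx.
Qed.

(** Zero Cauchy data are carried from 0 to a in finitely many steps of length 1 / (4 K). *)
Lemma solution_unique Y Y1 Y2 : solution a q al be Y Y1 Y2 -> Y 0 = 0 -> Y1 0 = 0 ->
  forall x, 0 <= x <= a -> Y x = 0 /\ Y1 x = 0.
Proof.
move=> sY Y0 Y10; pose d := (4 * K)^-1.
have d0 : 0 < d by rewrite invr_gt0 mulr_gt0.
have step n x : 0 <= x -> x <= a -> x <= n%:R * d -> Y x = 0 /\ Y1 x = 0.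
  elim: n x => [|n IH] x x0 xa.
    by rewrite mul0r => x0'; have -> : x = 0 by apply/eqP; rewrite eq_le x0 x0'.
  move=> xn; have [xn'|/ltW xn'] := leP x (n%:R * d); first exact: IH.
  have c0 : 0 <= n%:R * d by rewrite mulr_ge0 // ltW.
  have [Yc Y1c] := IH _ c0 (le_trans xn' xa) (lexx _).
  apply: (solution_vanish_step sY c0 xa _ Yc Y1c); last by rewrite xn' lexx.
  rewrite -ler_pdivlMr ?mulr_gt0 // mul1r -/d.
  by move: xn; rewrite -natr1 mulrDl mul1r; lra.
move=> x /andP[x0 xa]; apply: (step (Num.truncn (x / d)).+1) => //.
by rewrite -ler_pdivrMr // ltW // truncnS_gt.
Qed.

Lemma solution_eq Y Y1 Y2 Z Z1 Z2 :
  solution a q al be Y Y1 Y2 -> solution a q al be Z Z1 Z2 ->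
  Y 0 = Z 0 -> Y1 0 = Z1 0 -> forall x, 0 <= x <= a -> Y x = Z x /\ Y1 x = Z1 x.
Proof.
move=> sY sZ E E1 x xa.
have sW := solution_comb a_gt0 1 (-1) sY sZ.
have [] := solution_unique sW _ _ xa; rewrite ?E ?E1 ?mul1r ?mulN1r ?subrr //.
by move=> /eqP; rewrite subr_eq0 => /eqP -> /eqP; rewrite subr_eq0 => /eqP ->.
Qed.

End Uniqueness.

(** * A trace inequality for H^2 functions *)

Section Trace.
Variables (R : realType) (a : R).
Hypothesis a_gt0 : 0 < a.
Notation mu := (@lebesgue_measure R).
Variables y y1 y2 : R -> R.
Hypothesis Hy : H2 a y y1 y2.

Let dens x := y x ^+ 2 + y1 x ^+ 2 + y2 x ^+ 2.

Lemma H2_density_integrable : integrable_itv a dens.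
Proof.
have [[_ y2i] p p1] := (H2_primitive a_gt0 _ _ _).1 Hy.
have i0 := primitive_integrableM a_gt0 p (primitive_integrable a_gt0 p).
have i1 := primitive_integrableM a_gt0 p1 (primitive_integrable a_gt0 p1).
exact: (integrable_itvD (integrable_itvD i0 i1) y2i).
Qed.

Lemma H2norm2E : H2norm2 a y y1 y2 = (itvint dens 0 a)%:E.
Proof.
by rewrite /itvint /Rintegral fineK //; apply: integrable_fin_num H2_density_integrable.
Qed.

Lemma H2norm2_ge0 : 0 <= itvint dens 0 a.
Proof. by apply: itvint_ge0 => t _; rewrite /dens !addr_ge0 ?sqr_ge0. Qed.

(** From 2 |y y'| <= y^2 + y'^2, the variation of y^2 is at most the integral I of the density, so
    y(z)^2 <= dens(x) + I; then integrate in x over [0, a]. *)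
Lemma H2_trace z : 0 <= z <= a -> a * y z ^+ 2 <= (1 + a) * itvint dens 0 a.
Proof.
move=> za; have [_ p p1] := (H2_primitive a_gt0 _ _ _).1 Hy.
have di := H2_density_integrable; set I := itvint dens 0 a.
have [M M1] := primitive_bounded p1; have pp := primitive_mul a_gt0 p p M1.
have d0 t : 0 <= dens t by rewrite /dens !addr_ge0 ?sqr_ge0.
have var s t : 0 <= s -> s <= t -> t <= a -> `|y t * y t - y s * y s| <= I.
  move=> s0 st ta; have sa := le_trans st ta; have t0 := le_trans s0 st.
  have [ppi _] := pp.
  rewrite (primitive_sub pp s0 st ta); apply: le_trans (norm_itvint s0 ta ppi) _.
  apply: le_trans (_ : itvint dens s t <= _).
    apply: (le_itvint s0 ta) => //; first exact: integrable_itv_norm.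
    move=> r _; rewrite /dens ler_norml; have := sqr_ge0 (y2 r).
    have := sqr_ge0 (y r - y1 r); have := sqr_ge0 (y r + y1 r); nra.
  rewrite /I (@itvint_cat _ a 0 a (lexx 0) (lexx a) _ s) ?s0 //.
  rewrite (@itvint_cat _ a s a s0 (lexx a) _ t) ?st //.
  have i1 : 0 <= itvint dens 0 s by apply: itvint_ge0.
  have i2 : 0 <= itvint dens t a by apply: itvint_ge0.
  lra.
have yz x : 0 <= x <= a -> y z ^+ 2 <= dens x + I.
  move=> /andP[x0 xa]; have /andP[z0 za'] := za.
  have : `|y z * y z - y x * y x| <= I.
    by have [xz|/ltW zx] := leP x z; [exact: var|rewrite distrC; exact: var].
  rewrite ler_norml => /andP[_ H]; rewrite /dens expr2.
  have := sqr_ge0 (y1 x); have := sqr_ge0 (y2 x); rewrite -[y x ^+ 2]/(y x * y x); lra.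
have ci := integrable_itv_cst a (y z ^+ 2); have Ii := integrable_itv_cst a I.
have := le_itvint (lexx 0) (lexx a) ci (integrable_itvD di Ii) yz.
rewrite (itvintD (lexx 0) (lexx a) di Ii).
rewrite !(itvint_cst _ (ltW a_gt0)) -/I subr0; lra.
Qed.

End Trace.

(** * Eigenfunctions on the metric graph *)

Local Notation edge0 := ((0, 0, 0, 0) : nat * nat * int * int).

Lemma esum_ge_fin (R : realType) (T : finType) (I : choiceType)
    (f : T -> I) (g : I -> \bar R) :
  injective f -> (forall i, 0 <= g i)%E ->
  (\sum_(p : T) g (f p) <= \esum_(i in [set: I]) g i)%E.
Proof.
move=> finj g0; apply: esum_ge; exists [set` [seq f p | p <- enum T]];
  first by split=> //; exact: finite_seq.
have u : uniq [seq f p | p <- enum T] by rewrite map_inj_uniq ?enum_uniq.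
by rewrite -(fsbig_seq _ g u) big_map big_enum.
Qed.

Section Sums.
Variables (C : zmodType) (G : pgraph).
Implicit Types (H : (int * int) -> 'I_(pg_m G) -> C) (F : pg_V -> C).

Lemma sum_edges (h : nat * nat * int * int -> C) :
  \sum_(e <- pg_edges G) h e = \sum_(j < pg_m G) h (nth edge0 (pg_edges G) j).
Proof. by rewrite (big_nth edge0) big_mkord. Qed.

(** Rewrites the adjacency sum with the same two index sets, outgoing and incoming edges, as the
    Kirchhoff condition. *)
Lemma sum_neighbours F s i :
  \sum_(b <- neighbours G i) F (s + b.1, b.2) =
  \sum_(j < pg_m G | pg_src G j == i) F (terminus (s, j)) +
  \sum_(j < pg_m G | pg_dst G j == i)
    F (origin (G := G) ((s.1 - (pg_shift G j).1, s.2 - (pg_shift G j).2), j)).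
Proof.
rewrite big_flatten big_map sum_edges.
rewrite [in RHS]big_mkcond [X in _ + X]big_mkcond -big_split; apply: eq_bigr => j _.
rewrite big_cat -/(pg_src G j) -/(pg_dst G j) /=; congr (_ + _).
  by case: eqP => _; rewrite ?big_seq1 ?big_nil.
by case: eqP => _; rewrite ?big_seq1 ?big_nil.
Qed.

Lemma size_neighbours i : size (neighbours G i) =
  (\sum_(j < pg_m G | pg_src G j == i) 1 + \sum_(j < pg_m G | pg_dst G j == i) 1)%N.
Proof.
rewrite /neighbours size_flatten sumnE !big_map (big_nth edge0) big_mkord.
rewrite [in RHS]big_mkcond [X in (_ + X)%N]big_mkcond -big_split; apply: eq_bigr => j _.
by rewrite size_cat /pg_src /pg_dst; do 2 case: eqP.
Qed.

Lemma sum_neighbours_cst (c : C) i :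
  \sum_(j < pg_m G | pg_src G j == i) c + \sum_(j < pg_m G | pg_dst G j == i) c =
  c *+ size (neighbours G i).
Proof. by rewrite size_neighbours mulrnDr -!sumrMnr. Qed.

End Sums.

Definition regular (G : pgraph) (d : nat) : bool :=
  [&& (0 < d)%N, all (fun i => size (neighbours G i) == d) (iota 0 (pg_k G)) &
      all (fun e => (e.1.1.1 < pg_k G)%N && (e.1.1.2 < pg_k G)%N) (pg_edges G)].

Section Regular.
Variables (G : pgraph) (d : nat).
Hypothesis Gd : regular G d.

Lemma regular_src (j : 'I_(pg_m G)) : (pg_src G j < pg_k G)%N.
Proof. by have /and3P[_ _ /(all_nthP edge0)/(_ _ (ltn_ord j))/andP[]] := Gd. Qed.

Lemma regular_dst (j : 'I_(pg_m G)) : (pg_dst G j < pg_k G)%N.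
Proof. by have /and3P[_ _ /(all_nthP edge0)/(_ _ (ltn_ord j))/andP[]] := Gd. Qed.

Lemma regular_size i : (i < pg_k G)%N -> size (neighbours G i) = d.
Proof. by move=> ik; have /and3P[_ /allP/(_ i)/(_ _)/eqP-> //] := Gd; rewrite mem_iota. Qed.

(** Positive degree puts every vertex on an edge, so vertex values can be read off edge
    functions. *)
Lemma regular_edge i : (i < pg_k G)%N ->
  exists j : 'I_(pg_m G), pg_src G j = i \/ pg_dst G j = i.
Proof.
move=> ik; have := regular_size ik; rewrite size_neighbours => E.
have [d0 _ _] := and3P Gd; apply: contrapT => H.
suff : d = 0%N by case: (d) d0.
rewrite -E !big_pred0 // => j; apply/negbTE/eqP => Ej; apply: H; exists j.
  by right.
by left.
Qed.

End Regular.

Lemma sum_complex (R : rcfType) (I : Type) (r : seq I) (P : pred I) (u v : I -> R) :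
  \sum_(i <- r | P i) (u i +i* v i) =
  (\sum_(i <- r | P i) u i) +i* (\sum_(i <- r | P i) v i).
Proof. by elim/big_rec3: _ => // i x y z _ ->. Qed.

Lemma complex_Re_Im (R : rcfType) (z : R[i]) : z = Re z +i* Im z.
Proof. by case: z. Qed.

Section Eigenfamily.
Variables (R : realType) (G : pgraph) (a : R) (q : R -> R) (al be : R).

(** Complex form of [is_eigenfunction], with the vertex values F made explicit. *)
Definition eigenfamily (Y Y1 Y2 : pg_E G -> R -> R[i]) (F : pg_V -> R[i]) : Prop :=
  [/\ forall e, solution a q al be (Y e) (Y1 e) (Y2 e),
      (\esum_(e in [set: pg_E G])
        (H2norm2 a (fun x => Re (Y e x)) (fun x => Re (Y1 e x)) (fun x => Re (Y2 e x)) +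
         H2norm2 a (fun x => Im (Y e x)) (fun x => Im (Y1 e x)) (fun x => Im (Y2 e x)))
        < +oo)%E,
      forall e, Y e 0 = F (origin e) /\ Y e a = F (terminus e),
      forall (n : int * int) i,
        \sum_(j < pg_m G | pg_src G j == i) Y1 (n, j) 0 -
        \sum_(j < pg_m G | pg_dst G j == i)
          Y1 ((n.1 - (pg_shift G j).1, n.2 - (pg_shift G j).2), j) a = 0 &
      exists e x, 0 <= x <= a /\ Y e x <> 0].

Lemma point_spectrumP :
  point_spectrum G a q (al, be) <-> exists Y Y1 Y2 F, eigenfamily Y Y1 Y2 F.
Proof.
split.
  move=> [U [U1 [U2 [V [V1 [V2 H]]]]]]; have [HH [fin [[fU [fV FE]] [K [OD nz]]]]] := H.
  exists (fun e x => U e x +i* V e x), (fun e x => U1 e x +i* V1 e x).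
  exists (fun e x => U2 e x +i* V2 e x), (fun v => fU v +i* fV v); split=> //.
  - by move=> e; have [Hu Hv] := HH e; split=> //; exact: OD.
  - by move=> e; have [-> [-> [-> ->]]] := FE e.
  - move=> n i; have [Ku Kv] := K n i; rewrite !sum_complex.
    by apply/eqP; rewrite eq_complex /= Ku Kv eqxx.
  - have [e [x [xa UV]]] := nz; exists e, x; split=> // -[Ux Vx].
    by case: UV; rewrite ?Ux ?Vx eqxx.
move=> [Y [Y1 [Y2 [F [sY fin FE K nz]]]]].
exists (fun e x => Re (Y e x)), (fun e x => Re (Y1 e x)), (fun e x => Re (Y2 e x)).
exists (fun e x => Im (Y e x)), (fun e x => Im (Y1 e x)), (fun e x => Im (Y2 e x)).
split; first by move=> e; have [] := sY e.
split=> //; split.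
  exists (fun v => Re (F v)), (fun v => Im (F v)) => e.
  by have [-> ->] := FE e.
split.
  move=> n i; have := K n i.
  rewrite (eq_bigr (fun j => Re (Y1 (n, j) 0) +i* Im (Y1 (n, j) 0))); last first.
    by move=> j _; exact: complex_Re_Im.
  rewrite sum_complex [X in _ - X](eq_bigr
    (fun j : 'I_(pg_m G) =>
      Re (Y1 (n.1 - (pg_shift G j).1, n.2 - (pg_shift G j).2, j) a) +i*
      Im (Y1 (n.1 - (pg_shift G j).1, n.2 - (pg_shift G j).2, j) a))); last first.
    by move=> j _; exact: complex_Re_Im.
  by rewrite sum_complex => -[].
split; first by move=> e; have [] := sY e.
have [e [x [xa Yx]]] := nz; exists e, x; split=> //.
have [Rx|Rx] := eqVneq (Re (Y e x)) 0; last by left.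
by right; apply/eqP => Ix; apply: Yx; rewrite [LHS]complex_Re_Im Rx Ix.
Qed.

Hypothesis a_gt0 : 0 < a.

Lemma norm_sqr_complex (z : R[i]) : `|z| ^+ 2 = (Re z ^+ 2 + Im z ^+ 2)%:C.
Proof. by rewrite -add_Re2_Im2. Qed.

(** Each vertex of the orbit is assigned an incident edge, injectively, and the trace inequality
    bounds |F|^2 there by the H^2 norm on that edge. *)
Lemma eigenfamily_box_l2 d Y Y1 Y2 F : regular G d -> eigenfamily Y Y1 Y2 F ->
  forall i, (i < pg_k G)%N -> box_l2 (fun s => F (s, i)).
Proof.
move=> Gd [sY fin FE _ _] i ik.
set g := fun e => _ in fin; set E := (\esum_(e in _) g e)%E in fin.
have gE e : exists2 I : R, g e = I%:E & forall x, 0 <= x <= a ->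
    a * (Re (Y e x) ^+ 2 + Im (Y e x) ^+ 2) <= (1 + a) * I.
  have [Hu Hv _] := sY e; rewrite /g (H2norm2E a_gt0 Hu) (H2norm2E a_gt0 Hv) -EFinD.
  eexists; first by []; move=> x xa.
  by rewrite mulrDr [leRHS]mulrDr lerD ?H2_trace.
have g0 e : (0 <= g e)%E.
  have [I -> /(_ 0)] := gE e; rewrite lexx (ltW a_gt0) => /(_ isT) H; rewrite lee_fin.
  have a1 : 0 < 1 + a by rewrite addr_gt0.
  by rewrite -(pmulr_rge0 _ a1); apply: le_trans H;
    rewrite mulr_ge0 ?(ltW a_gt0) ?addr_ge0 ?sqr_ge0.
have E0 : (0 <= E)%E by apply: esum_ge0 => e _; exact: g0.
have Efin : E = (fine E)%:E by rewrite fineK // ge0_fin_numE.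
exists ((1 + a) / a * fine E) => N s.
(* One edge orbit serves the whole box; x is 0 or a according to whether the vertices are its
   origins or its termini. *)
suff [f [x [finj xa fF]]] : exists (f : 'I_N * 'I_N -> pg_E G) (x : R),
    [/\ injective f, 0 <= x <= a &
      forall p : 'I_N * 'I_N, F (s + (p.1%:Z, p.2%:Z), i) = Y (f p) x].
  under eq_bigr => p _ do rewrite fF norm_sqr_complex.
  rewrite -rmorph_sum lecR.
  pose I e := fine (g e); have gI e : g e = (I e)%:E by rewrite /I; have [J ->] := gE e.
  apply: le_trans (_ : \sum_(p : 'I_N * 'I_N) (1 + a) / a * I (f p) <= _).
    apply: ler_sum => p _; have [J J1 J2] := gE (f p).
    by rewrite mulrAC ler_pdivlMr // mulrC /I J1 /= J2.
  rewrite -mulr_sumr; apply: ler_wpM2l;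
    first by rewrite divr_ge0 ?(ltW a_gt0) ?addr_ge0 ?(ltW a_gt0).
  rewrite -lee_fin -Efin -sumEFin; apply: le_trans (esum_ge_fin finj g0).
  by apply: lee_sum => p _; rewrite gI.
have inj_shift (t : int * int) (j : 'I_(pg_m G)) :
    injective (fun p : 'I_N * 'I_N => ((s + (p.1%:Z, p.2%:Z)) - t, j)).
  move=> [x y] [x' y'] [] /addIr/addrI E1 /addIr/addrI E2.
  by case: E1 => /val_inj ->; case: E2 => /val_inj ->.
have [j [ji|ji]] := regular_edge Gd ik.
  exists (fun p : 'I_N * 'I_N => ((s + (p.1%:Z, p.2%:Z)) - 0, j)), 0; split;
    first exact: inj_shift.
    by rewrite lexx ltW.
  by move=> p; have [-> _] := FE ((s + (p.1%:Z, p.2%:Z)) - 0, j);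
    rewrite /origin /= subr0 ji.
exists (fun p : 'I_N * 'I_N => ((s + (p.1%:Z, p.2%:Z)) - pg_shift G j, j)), a; split;
  first exact: inj_shift.
  by rewrite lexx ltW.
move=> p; have [_ ->] := FE ((s + (p.1%:Z, p.2%:Z)) - pg_shift G j, j).
by rewrite /terminus /= ji !subrK.
Qed.

End Eigenfamily.

(** * Necessary conditions for an eigenvalue *)

Section SpectrumSubset.
Variables (R : realType) (G : pgraph) (a : R) (q : R -> R) (al be : R).
Variables (d : nat) (p : lpoly).
Hypothesis a_gt0 : 0 < a.
Hypothesis q_L2 : L2 a q.
Hypothesis q_even : {ae @lebesgue_measure R, forall x, x \in `[0, a] -> q x = q (a - x)}.
Hypothesis Gd : regular G d.
Hypothesis Gp : annihilates G p.

Let r0 : reflect_at a 0 = a. Proof. by rewrite /reflect_at subr0. Qed.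
Let ra : reflect_at a a = 0. Proof. by rewrite /reflect_at subrr. Qed.
Let a_in : 0 <= a <= a. Proof. by rewrite lexx ltW. Qed.

Lemma eigenfamily_vertex_eq0 Y Y1 Y2 F (mu : R[i]) :
  @eigenfamily R G a q al be Y Y1 Y2 F -> lead mu p != 0 ->
  (forall s i, (i < pg_k G)%N ->
    \sum_(b <- neighbours G i) F (s + b.1, b.2) = mu * F (s, i)) ->
  forall e : pg_E G, F (origin e) = 0 /\ F (terminus e) = 0.
Proof.
move=> famY mu0 FG.
(* F is unconstrained at indices that are not vertices of the graph; setting it to 0 there makes the
   adjacency equation hold at every index. *)
pose F' (v : pg_V) := if (v.2 < pg_k G)%N then F v else 0.
have F'0 : forall s i, (i < pg_k G)%N -> F' (s, i) = 0.
  apply: (l2_adjacency_eq0 Gp mu0).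
    move=> s i; have [ik|ik] := boolP (i < pg_k G)%N.
      rewrite {2}/F' /= ik -FG // !sum_neighbours; congr (_ + _); apply: eq_bigr => j _.
        by rewrite /F' /= (regular_dst Gd).
      by rewrite /F' /= (regular_src Gd).
    rewrite {2}/F' (negbTE ik) mulr0 sum_neighbours !big_pred0 ?addr0 // => j;
      apply/negbTE; apply: contra ik => /eqP <-.
      exact: (regular_dst Gd).
    exact: (regular_src Gd).
  move=> i ik; have [B FB] := eigenfamily_box_l2 a_gt0 Gd famY ik.
  exists B => N s; apply: le_trans (FB N s).
  by rewrite le_eqVlt; apply/orP; left; apply/eqP; apply: eq_bigr => j _; rewrite /F' /= ik.
move=> e; split.
  by have := F'0 e.1 _ (regular_src Gd e.2); rewrite /F' /= (regular_src Gd).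
have := F'0 (terminus e).1 _ (regular_dst Gd e.2).
by rewrite /F' /= (regular_dst Gd).
Qed.

Definition sine S S1 S2 := [/\ solution a q al be S S1 S2, S 0 = 0 & S1 0 = 1].

(** The Wronskian with S, evaluated at 0 and at a, gives the first relation; the second is the first
    one for the reflected solution. Together they form the Dirichlet-to-Neumann map of an edge. *)
Lemma sine_neumann S S1 S2 Z Z1 Z2 : sine S S1 S2 -> solution a q al be Z Z1 Z2 ->
  S a * Z1 a = Z a * S1 a - Z 0 /\ S a * Z1 0 = Z a - Z 0 * S1 a.
Proof.
move=> [sS S0 S10] sZ.
have rel W W1 W2 : solution a q al be W W1 W2 -> S a * W1 a = W a * S1 a - W 0.
  move=> sW; have := wronskian_cst a_gt0 q_L2 sW sS a_in.
  by rewrite S0 S10 mulr1 mul0r subr0 => <-; ring.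
split; first exact: rel sZ.
have := rel _ _ _ (solution_reflect a_gt0 q_even sZ); rewrite ra r0 mulrN => E.
by rewrite -[LHS]opprK E; ring.
Qed.

(** Without S, all solutions are proportional to one with nonzero value at 0. Then F satisfies the
    adjacency equation with eigenvalue d or -d, and must vanish. *)
Lemma sine_exists Y Y1 Y2 F : @eigenfamily R G a q al be Y Y1 Y2 F ->
  lead (d%:R : R[i]) p != 0 -> lead (- d%:R : R[i]) p != 0 ->
  exists S S1 S2, sine S S1 S2.
Proof.
move=> famY dp dn; have [sY _ FE _ [e [x [xa Yx]]]] := famY.
apply: contrapT => noS.
have W0 A A1 A2 B B1 B2 : solution a q al be A A1 A2 -> solution a q al be B B1 B2 ->
    A 0 * B1 0 - B 0 * A1 0 = 0.
  (* With w the Wronskian at 0, the combination (A(0) B - B(0) A) / w has value 0 and derivative 1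
     at 0. *)
  move=> sA sB; apply: contrapT => /eqP W; apply: noS; set w := _ - _ in W.
  have sS := solution_comb a_gt0 (- B 0 / w) (A 0 / w) sA sB.
  do 3 eexists; split; first exact: sS.
    by rewrite /=; ring.
  by rewrite /= mulrAC [X in _ + X]mulrAC -mulrDl -[RHS](divff W) /w; congr (_ / _); ring.
have Y0 : Y e 0 != 0.
  apply/eqP => Y0; have Y1n : Y1 e 0 != 0.
    by apply/eqP => Y10; have [] := solution_unique a_gt0 q_L2 (sY e) Y0 Y10 xa.
  apply: noS; have sS := solutionZ a_gt0 (Y1 e 0)^-1 (sY e).
  by do 3 eexists; split; [exact: sS | rewrite /= Y0 mulr0 | rewrite /= mulVf].
(* Proportionality makes this ratio common to all solutions; applied to the reflections it also
   gives Z(0) = r Z(a), whence r^2 = 1. *)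
pose r := Y e a / Y e 0.
have prop Z Z1 Z2 : solution a q al be Z Z1 Z2 -> Z a = r * Z 0.
  move=> sZ; have sc := solutionZ a_gt0 (Z 0 / Y e 0) (sY e).
  have [||-> _] := solution_eq a_gt0 q_L2 sZ sc _ _ a_in.
  - by rewrite /= divfK.
  - rewrite /= mulrAC; apply/(canRL (mulfK Y0)).
    by apply/eqP; rewrite -subr_eq0 mulrC; apply/eqP; exact: W0 (sY e) sZ.
  - by rewrite /r mulrAC [RHS]mulrC mulrA.
have Ft (e' : pg_E G) : F (terminus e') = r * F (origin e').
  by have [<- <-] := FE e'; exact: prop (sY e').
have Fo (e' : pg_E G) : F (origin e') = r * F (terminus e').
  have [<- <-] := FE e'.
  by have := prop _ _ _ (solution_reflect a_gt0 q_even (sY e')); rewrite ra r0.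
have Fe : F (origin e) != 0 by have [<- _] := FE e.
have r2 : r ^+ 2 = 1.
  by apply: (mulIf Fe); rewrite mul1r expr2 -mulrA -Ft -Fo.
have lr : lead (d%:R * r) p != 0.
  have /eqP : r ^+ 2 = 1 by []; rewrite sqrf_eq1 => /orP[] /eqP ->; rewrite ?mulr1 //.
  by rewrite mulrN1.
have [] := eigenfamily_vertex_eq0 famY lr _ e; last by move/eqP; rewrite (negbTE Fe).
move=> s i ik; rewrite sum_neighbours.
rewrite (eq_bigr (fun _ => r * F (s, i))); last first.
  by move=> j /eqP ji; rewrite Ft /origin /= ji.
rewrite [X in _ + X](eq_bigr (fun _ => r * F (s, i))); last first.
  by move=> j /eqP ji; rewrite Fo /terminus /= ji !subrK; case: (s).
by rewrite sum_neighbours_cst (regular_size Gd) // -mulrA mulr_natl.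
Qed.

(** If S(a) and the leading coefficient were both nonzero, the vertex values would vanish; then S(a)
    Y'(0) = 0 on every edge, and Y = 0 by uniqueness. *)
Lemma point_spectrum_sine :
  lead (d%:R : R[i]) p != 0 -> lead (- d%:R : R[i]) p != 0 ->
  point_spectrum G a q (al, be) ->
  exists S S1 S2, sine S S1 S2 /\ (S a = 0 \/ lead (d%:R * S1 a) p = 0).
Proof.
move=> dp dn /point_spectrumP[Y [Y1 [Y2 [F famY]]]].
have [S [S1 [S2 sS]]] := sine_exists famY dp dn.
exists S, S1, S2; split=> //; have [Sa|Sa] := eqVneq (S a) 0; [by left|right].
apply/eqP; apply: contrapT => /negP lc.
have [sY _ FE K [e [x [xa Yx]]]] := famY.
have [] := eigenfamily_vertex_eq0 famY lc _ e.
  move=> s i ik; apply/eqP; rewrite -subr_eq0; apply/eqP.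
  (* Multiplied by S(a), each outgoing derivative becomes the value at the other end minus S'(a)
     times the value at the vertex. *)
  have := congr1 (fun z => S a * z) (K s i); rewrite mulr0 mulrBr !mulr_sumr => E.
  apply: eq_trans E.
  rewrite sum_neighbours -mulrA mulr_natl -(regular_size Gd ik) -sum_neighbours_cst.
  rewrite opprD addrACA -!sumrB -sumrN; congr (_ + _); apply: eq_bigr => j /eqP ji.
    have [_ ->] := sine_neumann sS (sY (s, j)); have [-> ->] := FE (s, j).
    by rewrite [in X in _ = _ - X]/origin /= ji [S1 a * _]mulrC.
  set e' : pg_E G := (_, j); have [-> _] := sine_neumann sS (sY e').
  have [-> ->] := FE e'; rewrite opprB [in X in _ = _ - X]/terminus /e' /= ji !subrK.
  by case: (s) => s1 s2; rewrite [S1 a * _]mulrC.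
move=> Fo Ft; have [Y0 Ya] := FE e; rewrite {}Fo in Y0; rewrite {}Ft in Ya.
have [_] := sine_neumann sS (sY e); rewrite Y0 Ya mul0r subr0 => /eqP.
rewrite mulf_eq0 (negbTE Sa) /= => /eqP Y10.
by apply: Yx; have [] := solution_unique a_gt0 q_L2 (sY e) Y0 Y10 xa.
Qed.

End SpectrumSubset.

(** * Finite certificates for compactly supported eigenfunctions *)

Definition coef (L : fsum) (v : pg_V) : int :=
  foldr (fun t c => if t.2 == v then t.1 + c else c) 0 L.

Lemma coefE (C : pzRingType) (L : fsum) v :
  (coef L v)%:~R = \sum_(t <- L) t.1%:~R * (t.2 == v)%:R :> C.
Proof.
elim: L => [|t L IH]; rewrite ?big_nil // big_cons -IH /=.
by case: eqP => _; rewrite ?mulr1 ?rmorphD // mulr0 add0r.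
Qed.

Lemma coef_notin (L : fsum) n i : n \notin [seq t.2.1 | t <- L] -> coef L (n, i) = 0.
Proof.
elim: L => //= t L IH; rewrite inE negb_or => /andP[nt /IH ->].
by case: (t.2 =P (n, i)) nt => // ->; rewrite eqxx.
Qed.

(* Edges are encoded as (n, j), so a list of weighted edges has type [fsum]; [sigma]
   stands for S'(a). *)
Definition flow_boundary (G : pgraph) (sigma : int) (L : fsum) : fsum :=
  flatten [seq [:: (t.1, (t.2.1, pg_src G t.2.2));
      (- sigma * t.1, ((t.2.1.1 + (pg_shift G t.2.2).1, t.2.1.2 + (pg_shift G t.2.2).2),
        pg_dst G t.2.2))] | t <- L].

(** When S(a) = 0, placing c S on each edge gives outgoing derivatives c at the origin and -sigma c
    at the terminus; the vanishing boundary is the Kirchhoff condition. *)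
Definition balanced_flow (G : pgraph) (sigma : int) (L : fsum) : bool :=
  [&& all (fun t => t.2.2 < pg_m G)%N L, fsum_normal (flow_boundary G sigma L) == [::] &
      has (fun t => coef L t.2 != 0) L].

Definition adjacency_eigenvector (G : pgraph) (mu : int) (W : fsum) : bool :=
  (fsum_normal (fsum_step G W ++ [seq (- mu * t.1, t.2) | t <- W]) == [::]) &&
  has (fun t => (t.2.2 < pg_k G)%N && (coef W t.2 != 0)) W.

Section Certificates.
Variables (C : fieldType) (G : pgraph).

Lemma fsum_eval0 (F : pg_V -> C) (l : fsum) : fsum_normal l = [::] ->
  \sum_(t <- l) t.1%:~R * F t.2 = 0.
Proof.
move=> l0; have := fsum_eval_normal F 0 l; rewrite l0 {1}/fsum_eval big_nil => E;
  apply: eq_trans (esym E).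
by apply: eq_bigr => -[c [s i]] _; rewrite add0r.
Qed.

Lemma sum_coef (L : fsum) (P : pred 'I_(pg_m G)) (nn : 'I_(pg_m G) -> int * int) :
  \sum_(j | P j) (coef L (nn j, val j))%:~R =
  \sum_(t <- L) t.1%:~R * \sum_(j | P j) (t.2 == (nn j, val j))%:R :> C.
Proof.
under [RHS]eq_bigr => t _ do rewrite mulr_sumr.
by rewrite exchange_big; apply: eq_bigr => j _; exact: coefE.
Qed.

Lemma sum_delta (P : pred 'I_(pg_m G)) (nn : 'I_(pg_m G) -> int * int) s k
    (km : (k < pg_m G)%N) :
  \sum_(j | P j) ((s, k) == (nn j, val j))%:R =
  (P (Ordinal km) && (s == nn (Ordinal km)))%:R :> C.
Proof.
rewrite big_mkcond (bigD1 (Ordinal km)) //= big1 ?addr0 => [|j jk].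
  by rewrite xpair_eqE eqxx andbT; case: (P _).
case: ifP => // _; case: eqP => // -[_ kj]; case/eqP: jk; exact: val_inj.
Qed.

(** The zero formal sum [flow_boundary] is evaluated on the indicator function of the vertex (n,
    i). *)
Lemma balanced_flow_kirchhoff sigma L (n : int * int) i : balanced_flow G sigma L ->
  \sum_(j < pg_m G | pg_src G j == i) (coef L (n, val j))%:~R -
  sigma%:~R * \sum_(j < pg_m G | pg_dst G j == i)
    (coef L ((n.1 - (pg_shift G j).1, n.2 - (pg_shift G j).2), val j))%:~R = 0 :> C.
Proof.
case: n => n1 n2 /and3P[/allP Lm /eqP L0 _] /=.
have := fsum_eval0 (fun v => (v == (n1, n2, i))%:R) L0.
rewrite big_flatten big_map => E; apply: eq_trans E.
pose nn (j : 'I_(pg_m G)) := (n1 - (pg_shift G j).1, n2 - (pg_shift G j).2).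
rewrite (sum_coef L _ (fun=> (n1, n2))) (sum_coef L _ nn).
rewrite mulr_sumr -sumrB; apply: eq_big_seq => -[c [[s1 s2] k]] tL; have km := Lm _ tL.
rewrite !big_cons big_nil /= addr0 (sum_delta _ (fun=> (n1, n2)) _ km) (sum_delta _ nn
  _ km).
rewrite rmorphM rmorphN !mulNr mulrA; congr (_ * _ - _ * _).
  by rewrite xpair_eqE andbC.
rewrite /nn /= !xpair_eqE andbC.
by rewrite ![_ == _ - _]eq_sym !subr_eq ![_ == _ + _]eq_sym.
Qed.

(** Adjacency is symmetric. This turns [fsum_step], which pushes weights to neighbours, into a sum
    over neighbours. *)
Lemma neighbours_sym (v : pg_V) s i :
  \sum_(b <- neighbours G i) (v == (s + b.1, b.2))%:R =
  \sum_(b <- neighbours G v.2) ((v.1 + b.1, b.2) == (s, i))%:R :> C.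
Proof.
rewrite (@sum_neighbours C G (fun w => (v == w)%:R)) (@sum_neighbours C G (fun w =>
  (w == (s, i))%:R)).
rewrite [RHS]addrC; congr (_ + _); rewrite big_mkcond [RHS]big_mkcond.
  apply: eq_bigr => j _; rewrite /origin /terminus /=.
  case: v s => [[v1 v2] k] [s1 s2]; rewrite /= !xpair_eqE !subr_eq [k == _]eq_sym.
  by case: (_ == i); case: (_ == k); rewrite ?andbT ?andbF.
apply: eq_bigr => j _; rewrite /origin /terminus /=.
case: v s => [[v1 v2] k] [s1 s2]; rewrite /= !xpair_eqE.
rewrite [v1 == _]eq_sym [v2 == _]eq_sym !subr_eq [k == _]eq_sym [v1 + _ == _]eq_sym [v2
  + _ == _]eq_sym.
by case: (_ == i); case: (_ == k); rewrite ?andbT ?andbF.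
Qed.

Lemma adjacency_eigenvector_eq mu W : adjacency_eigenvector G mu W ->
  adjacency_eq G (mu%:~R : C) (fun v => (coef W v)%:~R).
Proof.
move=> /andP[/eqP W0 _] s i.
have := fsum_eval0 (fun v => (v == (s, i))%:R) W0.
rewrite big_cat big_flatten !big_map /= => /eqP; rewrite addr_eq0 => /eqP E.
under eq_bigr => b _ do rewrite coefE.
rewrite exchange_big /= coefE mulr_sumr.
under eq_bigr => t _ do rewrite -mulr_sumr neighbours_sym.
move: E; under eq_bigr => t _ do rewrite big_map -mulr_sumr /=.
move=> ->; rewrite -sumrN; apply: eq_bigr => t _.
by rewrite rmorphM rmorphN !mulNr opprK mulrA.
Qed.

End Certificates.

(** * Construction of eigenfunctions *)

Section SpectrumSupset.
Variables (R : realType) (G : pgraph) (a : R) (q : R -> R) (al be : R).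
Hypothesis a_gt0 : 0 < a.
Hypothesis q_L2 : L2 a q.
Hypothesis q_even : {ae @lebesgue_measure R, forall x, x \in `[0, a] -> q x = q (a - x)}.
Variables S S1 S2 : R -> R[i].
Hypothesis sS : sine a q al be S S1 S2.

Let r0 : reflect_at a 0 = a. Proof. by rewrite /reflect_at subr0. Qed.
Let ra : reflect_at a a = 0. Proof. by rewrite /reflect_at subrr. Qed.
Let a_in : 0 <= a <= a. Proof. by rewrite lexx ltW. Qed.

(** The reflection of S vanishes at 0 with derivative -S'(a), so it equals -S'(a) S; comparing
    derivatives at a gives S'(a)^2 = 1. *)
Lemma sine_sqr : S a = 0 -> S1 a = 1 \/ S1 a = -1.
Proof.
move=> Sa; have [sol S0 S10] := sS.
have sr := solution_reflect a_gt0 q_even sol.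
have sz := solutionZ a_gt0 (- S1 a) sol.
have [||_] := solution_eq a_gt0 q_L2 sr sz _ _ a_in.
- by rewrite /= r0 Sa S0 mulr0.
- by rewrite /= r0 S10 mulr1.
rewrite /= ra S10 mulNr => /oppr_inj /esym/eqP.
by rewrite -expr2 sqrf_eq1 => /orP[] /eqP ->; [left|right].
Qed.

(** If S vanished on [0, a], the equation would keep Re S' equal to 1, and integrating would give Re
    S(a) = a. *)
Lemma sine_neq0 : exists2 x, 0 <= x <= a & S x <> 0.
Proof.
apply: contrapT => H; have Sx x : 0 <= x <= a -> S x = 0.
  by move=> xa; apply: contrapT => Sx; apply: H; exists x.
have [sol S0 S10] := sS.
have [[_ uE] _ [_ u1E] _] := solution_primitive a_gt0 q_L2 sol.
have u1 x : 0 <= x <= a -> Re (S1 x) = 1.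
  move=> xa; rewrite (u1E x xa) S10 /= (@eq_itvint _ _ (fun=> 0)) => [|t /andP[t0 tx]].
    by rewrite itvint_cst ?mul0r ?addr0 //; case/andP: xa.
  by rewrite Sx /= ?mul0r ?mulr0 ?addr0 // t0 (le_trans tx) //; case/andP: xa.
have := uE a a_in; rewrite Sx // Sx ?lexx ?ltW // (@eq_itvint _ _ (fun=> 1)) //.
rewrite itvint_cst ?ltW // mul1r subr0 /= add0r => /eqP.
by rewrite eq_sym gt_eqF.
Qed.

(** The candidate on an edge is A S(x) + B S(a - x). [Ns] lists cells containing its support, [FAB]
    is continuity and [K] is the Kirchhoff condition. *)
Variables (A B : pg_E G -> R[i]) (F : pg_V -> R[i]) (Ns : seq (int * int)).
Hypothesis AB0 : forall e, e.1 \notin Ns -> A e = 0 /\ B e = 0.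
Hypothesis FAB : forall e, B e * S a = F (origin e) /\ A e * S a = F (terminus e).
Hypothesis K : forall (n : int * int) i,
  \sum_(j < pg_m G | pg_src G j == i) (A (n, j) - B (n, j) * S1 a) -
  \sum_(j < pg_m G | pg_dst G j == i)
     (A ((n.1 - (pg_shift G j).1, n.2 - (pg_shift G j).2), j) * S1 a -
      B ((n.1 - (pg_shift G j).1, n.2 - (pg_shift G j).2), j)) = 0.

Let Y e x := A e * S x + B e * S (reflect_at a x).
Let Y1 e x := A e * S1 x + B e * - S1 (reflect_at a x).
Let Y2 e x := A e * S2 x + B e * S2 (reflect_at a x).

Hypothesis nz : exists e x, 0 <= x <= a /\ Y e x <> 0.

Lemma point_spectrum_of_coefficients : point_spectrum G a q (al, be).
Proof.
have [sol S0 S10] := sS.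
have sY e : solution a q al be (Y e) (Y1 e) (Y2 e).
  exact: (solution_comb a_gt0 (A e) (B e) sol (solution_reflect a_gt0 q_even sol)).
apply/point_spectrumP; exists Y, Y1, Y2, F; split=> //.
- set g := fun e => _.
  have gI e : exists2 I : R, 0 <= I & g e = I%:E.
    have [Hu Hv _] := sY e; rewrite /g (H2norm2E a_gt0 Hu) (H2norm2E a_gt0 Hv) -EFinD.
    by eexists; last by []; apply: addr_ge0; exact: H2norm2_ge0.
  have g0 e : (0 <= g e)%E by have [I I0 ->] := gI e; rewrite lee_fin.
  (* Off the finitely many edges based in [Ns] the candidate is zero, so the norm is a finite sum of
     finite terms. *)
  rewrite (esumID [set e | e.1 \in Ns]); last by move=> e _; exact: g0.
  rewrite [X in (_ + X)%E]esum1 => [|e [_ /negP/AB0[Ae Be]]]; last first.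
    have Yz x : Y e x = 0 by rewrite /Y Ae Be !mul0r addr0.
    have Y1z x : Y1 e x = 0 by rewrite /Y1 Ae Be !mul0r addr0.
    have Y2z x : Y2 e x = 0 by rewrite /Y2 Ae Be !mul0r addr0.
    rewrite /g /H2norm2 !integral0_eq ?adde0 // => x _;
      by rewrite Yz Y1z Y2z /= expr0n /= !addr0.
  have finN : finite_set ([set: pg_E G] `&` [set e | e.1 \in Ns]).
    rewrite setTI; apply: (@sub_finite_set _ _ ([set` Ns] `*` [set: 'I_(pg_m G)])).
      by move=> e /= eN; split.
    by apply: finite_setX; [exact: finite_seq|exact: finite_finset].
  rewrite adde0 (esum_fset finN); last by move=> e _; exact: g0.
  by apply: lte_sum_pinfty => e _; have [I _] := gI e; rewrite /g => ->; rewrite ltry.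
- move=> e; have [<- <-] := FAB e; rewrite /Y r0 ra S0.
  by rewrite !mulr0 addr0 add0r.
- move=> n i; rewrite -[RHS](K n i); congr (_ - _); apply: eq_bigr => j _.
    by rewrite /Y1 r0 S10 mulr1 mulrN.
  by rewrite /Y1 ra S10 mulrN mulr1.
Qed.

End SpectrumSupset.

Section Constructions.
Variables (R : realType) (G : pgraph) (a : R) (q : R -> R) (al be : R).
Hypothesis a_gt0 : 0 < a.
Hypothesis q_L2 : L2 a q.
Hypothesis q_even : {ae @lebesgue_measure R, forall x, x \in `[0, a] -> q x = q (a - x)}.
Variables S S1 S2 : R -> R[i].
Hypothesis sS : sine a q al be S S1 S2.

Lemma intr_coef_neq0 (L : fsum) v : coef L v != 0 -> (coef L v)%:~R <> 0 :> R[i].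
Proof. by move=> c0 /eqP; rewrite intr_eq0 (negbTE c0). Qed.

Lemma point_spectrum_flow (L1 L2 : fsum) :
  balanced_flow G 1 L1 -> balanced_flow G (-1) L2 -> S a = 0 ->
  point_spectrum G a q (al, be).
Proof.
move=> H1 H2 Sa.
have [s [L [HL sE]]] : exists s L, balanced_flow G s L /\ S1 a = s%:~R.
  have [->|->] := sine_sqr a_gt0 q_L2 q_even sS Sa; first by exists 1, L1.
  by exists (-1), L2.
pose A (e : pg_E G) : R[i] := (coef L (e.1, val e.2))%:~R.
apply: (point_spectrum_of_coefficients a_gt0 q_even sS (A := A) (B := fun=> 0)
  (F := fun=> 0) (Ns := [seq t.2.1 | t <- L])).
- by move=> e /coef_notin; rewrite /A => ->.
- by move=> e; rewrite Sa !mulr0.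
- move=> n i; rewrite -[RHS](balanced_flow_kirchhoff R[i] n i HL) sE mulr_sumr.
  congr (_ - _); apply: eq_bigr => j _; rewrite ?mul0r ?subr0 //.
  by rewrite mulrC.
have [x xa Sx] := sine_neq0 a_gt0 q_L2 sS.
have /and3P[/allP Lm _ /hasP[[c [n j]] tL c0]] := HL.
exists (n, Ordinal (Lm _ tL)), x; split=> //.
rewrite mul0r addr0 /A /=; apply/eqP; rewrite mulf_neq0 //; last exact/eqP.
exact/eqP/intr_coef_neq0.
Qed.

(** Since S(a) is nonzero, the vertex values W extend to each edge by solutions; S(a) times their
    Kirchhoff condition is the adjacency equation with mu = d S'(a). *)
Lemma point_spectrum_eigenvector d (mu : int) (W : fsum) :
  regular G d -> adjacency_eigenvector G mu W -> S a != 0 -> d%:R * S1 a = mu%:~R ->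
  point_spectrum G a q (al, be).
Proof.
move=> Gd HW Sa mud.
pose F (v : pg_V) : R[i] := (coef W v)%:~R.
have FG := adjacency_eigenvector_eq R[i] HW.
(* An edge in the support has its origin or its terminus in the support of W; the second list shifts
   termini back to the base cells of their edges. *)
pose Ns := [seq t.2.1 | t <- W] ++
  flatten [seq [seq t.2.1 - pg_shift G j | t <- W] | j : 'I_(pg_m G)].
have [a_in z_in] : 0 <= a <= a /\ 0 <= (0 : R) <= a by rewrite !lexx ltW.
apply: (point_spectrum_of_coefficients a_gt0 q_even sS (A := fun e => F (terminus e) / S a)
  (B := fun e => F (origin e) / S a) (F := F) (Ns := Ns)).
- move=> e; rewrite mem_cat negb_or => /andP[e1 e2].
  have -> : F (origin e) = 0 by rewrite /F /origin coef_notin.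
  suff -> : F (terminus e) = 0 by rewrite mul0r.
  rewrite /F /terminus coef_notin //; apply: contra e2 => /mapP[t tW tE]; apply/flattenP.
  exists [seq t.2.1 - pg_shift G e.2 | t <- W]; first by apply: map_f; rewrite mem_enum.
  apply/mapP; exists t => //; rewrite -tE.
  by case: e {tE e1} => [[e1 e2] j]; congr (_, _); rewrite /= addrK.
- by move=> e; rewrite !divfK.
- move=> n i; have [ik|ik] := boolP (i < pg_k G)%N; last first.
    rewrite !big_pred0 ?subr0 // => j; apply/negbTE; apply: contra ik => /eqP <-.
      exact: (regular_dst Gd).
    exact: (regular_src Gd).
  apply: (mulIf Sa); rewrite mul0r mulrBl !mulr_suml.
  apply: (@eq_trans _ _ (\sum_(b <- neighbours G i) F (n + b.1, b.2) -
      (S1 a * F (n, i)) *+ size (neighbours G i))).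
    rewrite sum_neighbours -sum_neighbours_cst opprD addrACA -!sumrB -sumrN.
    congr (_ + _); apply: eq_bigr => j /eqP ji.
      by rewrite [in LHS]/origin /= ji; field.
    rewrite [in LHS]/terminus /= ji !subrK (_ : (n.1, n.2, i) = (n, i)); last by case: (n).
    by field.
  by rewrite FG (regular_size Gd ik) -mud -[X in _ - X]mulr_natl mulrA subrr.
have [_ S0 _] := sS.
have /andP[_ /hasP[[c [n i]] _ /andP[ik c0]]] := HW.
have Fni : F (n, i) <> 0 by exact: intr_coef_neq0.
have [j [ji|ji]] := regular_edge Gd ik.
  exists (n, j), 0; split=> //; rewrite S0 mulr0 add0r /reflect_at subr0 divfK //.
  by rewrite /origin /= ji.
exists (n - pg_shift G j, j), a; split=> //;
  rewrite /reflect_at subrr S0 mulr0 addr0 divfK //.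
by rewrite /terminus /= ji !subrK; case: (n) Fni.
Qed.

End Constructions.

(** * The five tilings *)

(** Around a dodecagon the sign changes along triangle edges and persists along the others. The two
    neighbours on the cycle cancel, as do the two values seen from the third vertex of each
    triangle. *)
Definition trH_vector0 : fsum := [:: (1, ((0, 0), 0%N)); (-1, ((-1, 0), 2%N));
  (-1, ((-1, 0), 4%N)); (1, ((-1, 0), 5%N)); (1, ((-1, 0), 1%N)); (-1, ((-1, 1), 0%N));
  (-1, ((-1, 1), 3%N)); (1, ((-1, 1), 4%N)); (1, ((-1, 1), 2%N)); (-1, ((0, 0), 1%N));
  (-1, ((0, 0), 5%N)); (1, ((0, 0), 3%N))]%Z.

(** Alternating signs around the same dodecagon: both neighbours on the cycle carry the opposite
    value, which gives the eigenvalue -2. *)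
Definition trH_vectorN2 : fsum := [:: (1, ((0, 0), 0%N)); (-1, ((-1, 0), 2%N));
  (1, ((-1, 0), 4%N)); (-1, ((-1, 0), 5%N)); (1, ((-1, 0), 1%N)); (-1, ((-1, 1), 0%N));
  (1, ((-1, 1), 3%N)); (-1, ((-1, 1), 4%N)); (1, ((-1, 1), 2%N)); (-1, ((0, 0), 1%N));
  (1, ((0, 0), 5%N)); (-1, ((0, 0), 3%N))]%Z.

(** Unit circulation around the dodecagon, with sign -1 on edges traversed against their
    orientation. The other tilings use cycles of length 4, or 6 for the snub trihexagonal one. *)
Definition trH_flow : fsum := [:: (1, ((0, 0), 0%N)); (1, ((-1, 0), 5%N));
  (1, ((-1, 0), 8%N)); (-1, ((-1, 0), 4%N)); (-1, ((-1, 1), 1%N)); (1, ((-1, 1), 2%N));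
  (1, ((-1, 1), 6%N)); (-1, ((-1, 1), 5%N)); (-1, ((0, 0), 3%N)); (1, ((0, 0), 4%N));
  (-1, ((0, 0), 7%N)); (-1, ((0, 0), 2%N))]%Z.

(** For sigma = -1 both ends of an edge contribute with the same sign, so weights alternating around
    an even cycle cancel at every vertex. *)
Definition trH_alternating_flow : fsum := [:: (1, ((0, 0), 0%N)); (-1, ((-1, 0), 5%N));
  (1, ((-1, 0), 8%N)); (-1, ((-1, 0), 4%N)); (1, ((-1, 1), 1%N)); (-1, ((-1, 1), 2%N));
  (1, ((-1, 1), 6%N)); (-1, ((-1, 1), 5%N)); (1, ((0, 0), 3%N)); (-1, ((0, 0), 4%N));
  (1, ((0, 0), 7%N)); (-1, ((0, 0), 2%N))]%Z.

Definition snS_flow : fsum := [:: (1, ((0, 0), 0%N)); (1, ((-1, 0), 5%N));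
  (1, ((-1, -1), 9%N)); (-1, ((0, 0), 2%N))]%Z.

Definition snS_alternating_flow : fsum := [:: (1, ((0, 0), 0%N)); (-1, ((-1, 0), 5%N));
  (1, ((-1, -1), 9%N)); (-1, ((0, 0), 2%N))]%Z.

Definition rTH_flow : fsum := [:: (1, ((0, 0), 0%N)); (1, ((-1, 0), 5%N));
  (1, ((-1, 0), 10%N)); (-1, ((0, 0), 3%N))]%Z.

Definition rTH_alternating_flow : fsum := [:: (1, ((0, 0), 0%N)); (-1, ((-1, 0), 5%N));
  (1, ((-1, 0), 10%N)); (-1, ((0, 0), 3%N))]%Z.

Definition snTH_flow : fsum := [:: (1, ((0, 0), 0%N)); (1, ((-1, 0), 5%N));
  (1, ((-1, 0), 9%N)); (1, ((-1, -1), 13%N)); (1, ((0, -1), 14%N));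
  (-1, ((0, 0), 2%N))]%Z.

Definition snTH_alternating_flow : fsum := [:: (1, ((0, 0), 0%N)); (-1, ((-1, 0), 5%N));
  (1, ((-1, 0), 9%N)); (-1, ((-1, -1), 13%N)); (1, ((0, -1), 14%N));
  (-1, ((0, 0), 2%N))]%Z.

Definition trTH_flow : fsum := [:: (1, ((0, 0), 0%N)); (-1, ((0, -1), 13%N));
  (-1, ((0, 0), 11%N)); (-1, ((0, 0), 2%N))]%Z.

Definition trTH_alternating_flow : fsum := [:: (1, ((0, 0), 0%N));
  (-1, ((0, -1), 13%N)); (1, ((0, 0), 11%N)); (-1, ((0, 0), 2%N))]%Z.

Section PointSpectrum.
Variables (R : realType) (a : R) (q : R -> R).
Hypothesis a_gt0 : 0 < a.
Hypothesis q_L2 : L2 a q.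
Hypothesis q_even : {ae @lebesgue_measure R, forall x, x \in `[0, a] -> q x = q (a - x)}.

Lemma S_setP (P : R -> R -> R -> R -> Prop) al be :
  S_set a q P (al, be) <-> exists S S1 S2,
    sine a q al be S S1 S2 /\ P (Re (S a)) (Im (S a)) (Re (S1 a)) (Im (S1 a)).
Proof.
split=> [[u [u1 [u2 [v [v1 [v2 [[Hu [Hv [Oq [u0 [v0 [u10 v10]]]]]] Pa]]]]]]]|].
  exists (fun x => u x +i* v x), (fun x => u1 x +i* v1 x), (fun x => u2 x +i* v2 x).
  by split=> //; split; rewrite ?u0 ?v0 ?u10 ?v10.
move=> [S [S1 [S2 [[[Hu Hv Oq] S0 S10] Pa]]]].
exists (fun x => Re (S x)), (fun x => Re (S1 x)), (fun x => Re (S2 x)).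
exists (fun x => Im (S x)), (fun x => Im (S1 x)), (fun x => Im (S2 x)).
by split=> //; do 3 split=> //; rewrite S0 S10.
Qed.

Lemma complex_eq (z : R[i]) (x : R) : z = x%:C <-> Re z = x /\ Im z = 0.
Proof. by case: z => u v; split=> [[-> ->]//|[/= -> ->]]. Qed.

(** A leading coefficient identically 1 leaves S(a) = 0 as the only alternative at an eigenvalue,
    and the two flows realise it. *)
Lemma point_spectrum_dirichlet (G : pgraph) (d : nat) (p : lpoly) (L1 L2 : fsum) :
  regular G d -> annihilates G p -> (forall mu : R[i], lead mu p = 1) ->
  balanced_flow G 1 L1 -> balanced_flow G (-1) L2 ->
  point_spectrum G a q = S_set a q (fun Sr Si _ _ => Sr = 0 /\ Si = 0).
Proof.
move=> Gd Gp p1 HL1 HL2; apply/seteqP; split=> -[al be].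
  move=> /(point_spectrum_sine a_gt0 q_L2 q_even Gd Gp); rewrite !p1 oner_eq0.
  move=> /(_ isT isT)[S [S1 [S2 [sS [Sa|/eqP]]]]]; last by rewrite p1 oner_eq0.
  by apply/S_setP; exists S, S1, S2; split=> //; rewrite Sa.
move=> /S_setP[S [S1 [S2 [sS /(complex_eq _ 0).2 Sa]]]].
exact: (point_spectrum_flow a_gt0 q_L2 q_even sS HL1 HL2 Sa).
Qed.

Lemma point_spectrum_trH : point_spectrum trH_tiling a q =
  S_set a q (fun Sr Si S'r S'i =>
    (Sr = 0 /\ Si = 0) \/ (S'r = 0 /\ S'i = 0) \/ (S'r = - (2 / 3) /\ S'i = 0)).
Proof.
have Gd : regular trH_tiling 3 by [].
apply/seteqP; split=> -[al be].
  have n3 : (3%:R : R[i]) != 0 by rewrite pnatr_eq0.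
  have l3 : lead (3%:R : R[i]) trH_cert != 0.
    rewrite trH_lead (_ : - _ = - 15%:R); last by ring.
    by rewrite oppr_eq0 pnatr_eq0.
  have lN3 : lead (- 3%:R : R[i]) trH_cert != 0.
    rewrite trH_lead (_ : - _ = - 3%:R); last by ring.
    by rewrite oppr_eq0 pnatr_eq0.
  move=> /(point_spectrum_sine a_gt0 q_L2 q_even Gd trH_annihilates l3 lN3).
  move=> [S [S1 [S2 [sS H]]]].
  apply/S_setP; exists S, S1, S2; split=> //.
  case: H => [->|/eqP]; first by left.
  rewrite trH_lead oppr_eq0 !mulf_eq0 (negbTE n3) /= => /orP[/eqP ->|H];
    first by right; left.
  right; right; apply/complex_eq; apply: (mulfI n3); move: H; rewrite addr_eq0 => /eqP ->.
  by rewrite rmorphN rmorphM fmorphV !rmorph_nat; field.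
move=> /S_setP[S [S1 [S2 [sS H]]]].
(* The case S(a) = 0 is settled first, because the dodecagon eigenvectors are extended to edges by
   dividing by S(a). *)
have [Sa|Sa] := eqVneq (S a) 0.
  exact: (point_spectrum_flow a_gt0 q_L2 q_even sS (L1 := trH_flow) (L2 :=
    trH_alternating_flow)).
case: H => [/(complex_eq _ 0).2 /eqP|]; first by rewrite (negbTE Sa).
case=> /complex_eq Ca.
  apply: (point_spectrum_eigenvector a_gt0 q_even sS (mu := 0) (W := trH_vector0) Gd) => //.
  by rewrite Ca mulr0.
apply: (point_spectrum_eigenvector a_gt0 q_even sS (mu := -2) (W := trH_vectorN2) Gd) => //.
by rewrite Ca rmorphN rmorphM fmorphV !rmorph_nat rmorphN; field.
Qed.

End PointSpectrum.

Theorem theorem7p1 (R : realType) (a : R) (q : R -> R) :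
  0 < a -> L2 a q ->
  {ae @lebesgue_measure R, forall x, x \in `[0, a] -> q x = q (a - x)} ->
  point_spectrum trH_tiling a q =
    S_set a q (fun Sr Si S'r S'i =>
      (Sr = 0 /\ Si = 0) \/ (S'r = 0 /\ S'i = 0) \/ (S'r = - (2 / 3) /\ S'i = 0)) /\
  point_spectrum snS_tiling a q = S_set a q (fun Sr Si _ _ => Sr = 0 /\ Si = 0) /\
  point_spectrum rTH_tiling a q = S_set a q (fun Sr Si _ _ => Sr = 0 /\ Si = 0) /\
  point_spectrum snTH_tiling a q = S_set a q (fun Sr Si _ _ => Sr = 0 /\ Si = 0) /\
  point_spectrum trTH_tiling a q = S_set a q (fun Sr Si _ _ => Sr = 0 /\ Si = 0).
Proof.
move=> a_gt0 q_L2 q_even; split; first exact: point_spectrum_trH.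
split.
  by apply: (point_spectrum_dirichlet a_gt0 q_L2 q_even (d := 5)
    (L1 := snS_flow) (L2 := snS_alternating_flow) _ snS_annihilates) => //; exact: snS_lead.
split.
  by apply: (point_spectrum_dirichlet a_gt0 q_L2 q_even (d := 4)
    (L1 := rTH_flow) (L2 := rTH_alternating_flow) _ rTH_annihilates) => //; exact: rTH_lead.
split.
  by apply: (point_spectrum_dirichlet a_gt0 q_L2 q_even (d := 5)
    (L1 := snTH_flow) (L2 := snTH_alternating_flow) _ snTH_annihilates) => //;
      exact: snTH_lead.
by apply: (point_spectrum_dirichlet a_gt0 q_L2 q_even (d := 3)
  (L1 := trTH_flow) (L2 := trTH_alternating_flow) _ trTH_annihilates) => //;
    exact: trTH_lead.
Qed.
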